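(* The nilpotent orbits form a connected component in the poset of adjoint orbits of $G$ in $\mathfrak{g}$ (partially ordered by the closure order).
   Context: $G$ is a connected, simply-connected semisimple linear algebraic group over $\mathbb{C}$ with Lie algebra $\mathfrak{g}$. Adjoint orbits are the $G$-orbits $\mathcal{O}(x)=\{\mathrm{Ad}_g(x):g\in G\}$, $x\in\mathfrak{g}$. An element $x\in\mathfrak{g}$ is nilpotent if $\mathrm{ad}_x:\mathfrak{g}\to\mathfrak{g}$ is nilpotent; an adjoint orbit is a nilpotent orbit if it contains (equivalently, consists of) nilpotent elements. The closure order on adjoint orbits is $\mathcal{O}_1\leq\mathcal{O}_2\iff\mathcal{O}_1\subseteq\overline{\mathcal{O}_2}$ (Zariski closure in $\mathfrak{g}$); it is a partial order. A subset $Q$ of a poset is called a connected component if it is maximal (among subsets) with respect to the following property: if $p,q\in Q$, then there exists a sequence $r_1,\ldots,r_k\in Q$ with $r_1=p$, $r_k=q$ and, for all $j\in\{1,\ldots,k-1\}$, $r_j\leq r_{j+1}$ or $r_j\geq r_{j+1}$. *)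

(* Defs.v *)
From mathcomp Require Import all_boot all_order all_algebra.
From mathcomp Require Import classical_sets reals.
From mathcomp Require Import topology normedtype.
From mathcomp Require Import complex.
(* Not imported: its notations clash with those of MathComp-Analysis. *)
From mathcomp Require mpoly.

Set Implicit Arguments.
Unset Strict Implicit.
Unset Printing Implicit Defensive.

Import Order.TTheory GRing.Theory Num.Theory numFieldNormedType.Exports.
Local Open Scope classical_set_scope.
Local Open Scope ring_scope.

(* R[i] itself carries no canonical topology; seen through a numeric field
   structure it gets the one of the modulus, and 'M[Cplx R]_n the product
   (Euclidean) topology. *)
Definition Cplx (R : realType) : numClosedFieldType := complex R.

Section Poset.
Variables (T : Type) (le : T -> T -> Prop).

Definition zigzag_connected (Q : set T) : Prop :=
  forall p q, Q p -> Q q ->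
    exists (k : nat) (r : nat -> T),
      [/\ (1 <= k)%N,
          forall j, (1 <= j <= k)%N -> Q (r j),
          r 1%N = p,
          r k = q &
          forall j, (1 <= j <= k.-1)%N -> le (r j) (r j.+1) \/ le (r j.+1) (r j)].

(* Connected components of the poset with underlying set P ordered by le. *)
Definition poset_component (P Q : set T) : Prop :=
  [/\ Q `<=` P,
      zigzag_connected Q &
      forall Q' : set T, Q' `<=` P -> Q `<=` Q' -> zigzag_connected Q' ->
        Q' `<=` Q].

End Poset.

Section AlgebraicGroups.
Variables (K : numClosedFieldType) (n : nat).
Implicit Types (A G H O Z : set 'M[K]_n) (X Y g h : 'M[K]_n).

(* Polynomials in the n * n matrix entries, listed in the order of mxvec. *)
Definition mxpolynomial := mpoly.mpoly (n * n) K.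

Definition mxeval (f : mxpolynomial) X : K :=
  mpoly.meval (fun k => mxvec X 0 k) f.

Definition zero_locus (S : set mxpolynomial) : set 'M[K]_n :=
  [set X | forall f, S f -> mxeval f X = 0].

Definition vanishing_ideal A : set mxpolynomial :=
  [set f | forall X, A X -> mxeval f X = 0].

Definition zariski_closed Z : Prop := exists S, Z = zero_locus S.

Definition zariski_closure A : set 'M[K]_n := zero_locus (vanishing_ideal A).

Definition zariski_connected A : Prop :=
  forall Z1 Z2, zariski_closed Z1 -> zariski_closed Z2 ->
    A `<=` Z1 `|` Z2 -> A `&` Z1 `&` Z2 = set0 ->
    A `&` Z1 = set0 \/ A `&` Z2 = set0.

Definition GL : set 'M[K]_n := [set X | X \in unitmx].

Definition subgroup H : Prop :=
  [/\ H `<=` GL,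
      H 1%:M,
      forall g h, H g -> H h -> H (g *m h) &
      forall g, H g -> H (invmx g)].

(* Linear algebraic groups, as Zariski closed subgroups of GL_n. *)
Definition linear_algebraic_group G : Prop :=
  subgroup G /\ exists Z, zariski_closed Z /\ G = Z `&` GL.

Definition normal_in H G : Prop :=
  H `<=` G /\ forall g h, G g -> H h -> H (g *m h *m invmx g).

Definition generated A : set 'M[K]_n :=
  [set X | forall H, subgroup H -> A `<=` H -> H X].

Definition derived H : set 'M[K]_n :=
  generated [set X | exists g h,
    [/\ H g, H h & X = g *m h *m invmx g *m invmx h]].

Definition solvable_group H : Prop :=
  exists k : nat, iter k derived H = [set 1%:M].

(* The radical of G is trivial. *)
Definition semisimple G : Prop :=
  forall H, linear_algebraic_group H -> zariski_connected H ->
    solvable_group H -> normal_in H G -> H = [set 1%:M].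

(* The tangent space of G at the identity matrix; the bracket on it is the
   commutator, and the adjoint action is conjugation. *)
Definition Lie G : set 'M[K]_n :=
  [set X | forall f, vanishing_ideal G f ->
     \sum_(k < n * n) mxeval (mpoly.mderiv k f) 1%:M * mxvec X 0 k = 0].

Definition ad X Y : 'M[K]_n := X *m Y - Y *m X.

Definition nilpotent_element G X : Prop :=
  Lie G X /\
  exists k : nat, forall Y, Lie G Y -> iter k (ad X) Y = 0.

Definition Ad g X : 'M[K]_n := g *m X *m invmx g.

Definition adjoint_orbit G X : set 'M[K]_n := [set Ad g X | g in G].

Definition adjoint_orbits G : set (set 'M[K]_n) :=
  [set O | exists X, Lie G X /\ O = adjoint_orbit G X].

Definition nilpotent_orbits G : set (set 'M[K]_n) :=
  [set O | adjoint_orbits G O /\ exists X, O X /\ nilpotent_element G X].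

(* Lie G is a linear subspace of 'M_n, so its polynomial functions are the
   restrictions of those of 'M_n. *)
Definition Lie_closure G O : set 'M[K]_n := Lie G `&` zariski_closure O.

Definition closure_order G (O1 O2 : set 'M[K]_n) : Prop :=
  O1 `<=` Lie_closure G O2.

End AlgebraicGroups.

(* Path-connected, and every loop is null-homotopic rel endpoints, for the
   Euclidean topology. *)
Definition simply_connected (R : realType) (n : nat)
    (G : set 'M[Cplx R]_n) : Prop :=
  let I : set R := [set t | 0 <= t <= 1] in
  [/\ G !=set0,
      forall x y, G x -> G y ->
        exists c : R -> 'M[Cplx R]_n,
          [/\ {within I, continuous c}, forall t, I t -> G (c t),
              c 0 = x & c 1 = y] &
      forall c : R -> 'M[Cplx R]_n,
        {within I, continuous c} -> (forall t, I t -> G (c t)) -> c 0 = c 1 ->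
        exists H : R * R -> 'M[Cplx R]_n,
          [/\ {within I `*` I, continuous H},
              forall p, (I `*` I) p -> G (H p),
              forall t, I t -> H (0, t) = c t,
              forall t, I t -> H (1, t) = c 0 &
              forall s, I s -> H (s, 0) = c 0 /\ H (s, 1) = c 0]].

(* Main.v *)
(* Write g for the Lie algebra of G.  For X in g the derivation
   f |-> (h |-> df_h(hX)) preserves the ideal of G.  Decomposing it into
   generalised eigenspaces shows that, if X has spectral idempotents e_l, then
   sum_l phi(l) e_l is in g for every additive phi : K -> K, and
   sum_l psi(l) e_l is in G for every homomorphism psi : (K, +) -> K^*.
   These two facts replace the exponential of a matrix that is not nilpotent.

   A family of pairwise commuting elements of G that is stable under
   conjugation and made of curves through 1 generates a connected abelian normal
   subgroup, so it is trivial.  This is used twice.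
   - The radical of the trace form tr(XY) on g consists of nilpotent matrices,
     because tr(X conj(X_s)) is the sum of the |l|^2; by Engel's theorem its
     centre is nonzero unless it vanishes, and the exponentials of the centre
     are such a family.  Hence the trace form is nondegenerate.
   - If X is ad-nilpotent on g, its idempotents commute with g, and the elements
     sum_l exp(Re(cl)) e_l form such a family.  Hence X is a nilpotent matrix.

   If X in g is nilpotent, nondegeneracy gives H in g with [H, X] = X, and
   psi(H) X psi(H)^-1 = psi(1) X puts 0 in the closure of the orbit of X, so
   every nilpotent orbit is above {0}.  Conversely the characteristic polynomial
   is constant on orbit closures, so an orbit comparable to a nilpotent one is
   nilpotent. *)

Require Import Defs.
From HB Require Import structures.
From mathcomp Require Import all_boot all_order all_algebra all_field.
From mathcomp Require Import ring zify.
From mathcomp Require Import boolp classical_sets reals.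
From mathcomp Require mpoly.

Set Implicit Arguments.
Unset Strict Implicit.
Unset Printing Implicit Defensive.

Import Order.TTheory GRing.Theory Num.Theory.
Local Open Scope ring_scope.

(** * Polynomial functions and derivations on matrices *)

Section Derivation.
Import mpoly.
Variables (K : numClosedFieldType) (n : nat).
Implicit Types (f p q : mxpolynomial K n) (X Y h : 'M[K]_n).

Local Notation cst := (@mpolyC (n * n) K).

Definition varmx : 'M[{mpoly K[n * n]}]_n := \matrix_(i, j) 'X_(mxvec_index i j).

Lemma mxevalD p q X : mxeval (p + q) X = mxeval p X + mxeval q X.
Proof. exact: mevalD. Qed.

Lemma mxevalM p q X : mxeval (p * q) X = mxeval p X * mxeval q X.
Proof. exact: mevalM. Qed.

Lemma mxevalC c X : mxeval (cst c) X = c.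
Proof. exact: mevalC. Qed.

Lemma mxevalZ c p X : mxeval (c *: p) X = c * mxeval p X.
Proof. exact: mevalZ. Qed.

Lemma mxeval_sum (I : Type) (s : seq I) (P : pred I) (F : I -> mxpolynomial K n) X :
  mxeval (\sum_(i <- s | P i) F i) X = \sum_(i <- s | P i) mxeval (F i) X.
Proof. exact: (raddf_sum (meval _)). Qed.

Lemma mxeval_gen i j X : mxeval (varmx i j) X = X i j.
Proof. by rewrite mxE /mxeval mevalXU mxvecE. Qed.

Lemma mxpoly_ind (P : mxpolynomial K n -> Prop) :
    (forall c, P (cst c)) -> (forall i j, P (varmx i j)) ->
    (forall p q, P p -> P q -> P (p + q)) ->
    (forall p q, P p -> P q -> P (p * q)) ->
  forall p, P p.
Proof.
move=> PC PX PD PM p; rewrite (mpolyE p).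
apply: (big_ind P) => [||m _]; first by rewrite -mpolyC0.
  exact: PD.
rewrite -mul_mpolyC; apply: (PM) => //; rewrite mpolyXE_id.
apply: (big_ind P) => [||k _]; first by rewrite -mpolyC1.
  exact: PM.
elim: (m k) => [|r IH]; first by rewrite expr0 -mpolyC1.
rewrite exprS; apply: PM => //.
by case/mxvec_indexP: k {IH} => i j; have := PX i j; rewrite mxE.
Qed.

(** The differential of [f] at [X] in the direction [Y]. [Lie G] consists of the [Y] killed by the
    differentials at the identity of all [f] in the ideal of [G]. *)
Definition dmx f X Y : K :=
  \sum_(k < n * n) mxeval (mderiv k f) X * mxvec Y 0 k.

Lemma dmxC c X Y : dmx (cst c) X Y = 0.
Proof.
by rewrite /dmx big1 // => k _; rewrite mderivC /mxeval meval0 mul0r.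
Qed.

Lemma dmxD p q X Y : dmx (p + q) X Y = dmx p X Y + dmx q X Y.
Proof.
by rewrite /dmx -big_split; apply: eq_bigr => k _; rewrite mderivD mxevalD mulrDl.
Qed.

Lemma dmxM p q X Y :
  dmx (p * q) X Y = dmx p X Y * mxeval q X + mxeval p X * dmx q X Y.
Proof.
rewrite /dmx mulr_suml mulr_sumr -big_split; apply: eq_bigr => k _ /=.
by rewrite mderivM mxevalD !mxevalM mulrDl mulrAC mulrA.
Qed.

Lemma mderiv_gen i j k : mderiv k (varmx i j) = (mxvec_index i j == k)%:R.
Proof.
rewrite mxE mderivX mnm1E; case: eqP => [->|]; last by rewrite scale0r.
by rewrite scale1r -[X in (X - _)%MM]add0m addmK mpolyX0.
Qed.

Lemma dmx_gen i j X Y : dmx (varmx i j) X Y = Y i j.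
Proof.
rewrite /dmx (bigD1 (mxvec_index i j)) //= big1 => [|k /negbTE neq].
  by rewrite mderiv_gen eqxx mxvecE /mxeval meval1 mul1r addr0.
by rewrite mderiv_gen eq_sym neq /mxeval meval0 mul0r.
Qed.

Lemma dmx_linear f X a Y Z : dmx f X (a *: Y + Z) = a * dmx f X Y + dmx f X Z.
Proof.
rewrite /dmx mulr_sumr -big_split; apply: eq_bigr => k _ /=.
by rewrite linearP !mxE mulrDr mulrCA.
Qed.

(** The chain rule along a polynomial curve of matrices. It turns statements about differentials
    into statements about one-variable polynomials. *)
Lemma mxeval_curve f (M : 'M[{poly K}]_n) : exists c : {poly K},
  forall t, let ev := map_mx (horner^~ t) in
    c.[t] = mxeval f (ev M) /\ c^`().[t] = dmx f (ev M) (ev (map_mx (@deriv _) M)).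
Proof.
elim/mxpoly_ind: f => [c|i j|p q [c Hc] [d Hd]|p q [c Hc] [d Hd]].
- by exists c%:P => t ev; rewrite derivC mxevalC dmxC hornerC horner0.
- by exists (M i j) => t ev; rewrite mxeval_gen dmx_gen !mxE.
- exists (c + d) => t ev; have [? ?] := Hc t; have [? ?] := Hd t.
  by rewrite derivD !hornerD mxevalD dmxD; split; congr (_ + _).
- exists (c * d) => t ev; have [c0 c1] := Hc t; have [d0 d1] := Hd t.
  by rewrite derivM !hornerE mxevalM dmxM c0 d0 c1 d1.
Qed.

(* The left-invariant derivation h |-> df_h(hX), see [mxeval_mxderiv]. *)
Definition mxderiv X f : mxpolynomial K n :=
  \sum_(k < n * n) mderiv k f * mxvec (varmx *m map_mx cst X) 0 k.

Lemma mxderivC X c : mxderiv X (cst c) = 0.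
Proof. by rewrite /mxderiv big1 // => k _; rewrite mderivC mul0r. Qed.

Lemma mxderiv_linear X : linear (mxderiv X).
Proof.
move=> a p q; rewrite /mxderiv scaler_sumr -big_split; apply: eq_bigr => k _ /=.
by rewrite mderivD mderivZ mulrDl scalerAl.
Qed.

HB.instance Definition _ X := GRing.isLinear.Build K
  {mpoly K[n * n]} {mpoly K[n * n]} *:%R (mxderiv X) (@mxderiv_linear X).

Lemma mxderivM X p q : mxderiv X (p * q) = mxderiv X p * q + p * mxderiv X q.
Proof.
rewrite /mxderiv mulr_suml mulr_sumr -big_split; apply: eq_bigr => k _ /=.
by rewrite mderivM mulrDl mulrAC mulrA.
Qed.

Lemma mxderiv_gen X i j :
  mxderiv X (varmx i j) = (varmx *m map_mx cst X) i j.
Proof.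
rewrite /mxderiv (bigD1 (mxvec_index i j)) //= big1 => [|k /negbTE neq].
  by rewrite mderiv_gen eqxx mxvecE mul1r addr0.
by rewrite mderiv_gen eq_sym neq mul0r.
Qed.

Lemma mxeval_mul h Y i j :
  mxeval ((varmx *m map_mx cst Y) i j) h = (h *m Y) i j.
Proof.
rewrite !mxE mxeval_sum; apply: eq_bigr => k _.
by rewrite mxevalM mxeval_gen mxE mxevalC.
Qed.

Lemma mxeval_mxderiv X f h : mxeval (mxderiv X f) h = dmx f h (h *m X).
Proof.
rewrite /mxderiv mxeval_sum; apply: eq_bigr => k _; rewrite mxevalM; congr (_ * _).
by case/mxvec_indexP: k => i j; rewrite !mxvecE mxeval_mul.
Qed.

Lemma mxderiv_mul X Y i j :
  mxderiv X ((varmx *m map_mx cst Y) i j) =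
  (varmx *m map_mx cst (X *m Y)) i j.
Proof.
rewrite map_mxM mulmxA !mxE linear_sum; apply: eq_bigr => k _.
rewrite /= mxderivM; by rewrite [map_mx _ Y k j]mxE mxderivC mulr0 addr0 mxderiv_gen.
Qed.

(** Both sides are derivations in [f], so comparing them on coordinate functions suffices, where
    [mxderiv_mul] computes them; in the product case the cross terms cancel. *)
Lemma mxderiv_bracket X Y f :
  mxderiv X (mxderiv Y f) - mxderiv Y (mxderiv X f) = mxderiv (X *m Y - Y *m X) f.
Proof.
elim/mxpoly_ind: f => [c|i j|p q Hp Hq|p q Hp Hq].
- by rewrite !mxderivC !linear0 addr0.
- by rewrite !mxderiv_gen !mxderiv_mul map_mxB mulmxBr [in RHS]mxE [X in _ = _ + X]mxE.
- by rewrite !linearD /= -Hp -Hq addrACA.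
- have aux (A : comNzRingType) (a b c d p' q' u v w z : A) :
      a * q' + v * w + (u * z + p' * c) - (b * q' + u * z + (v * w + p' * d)) =
      (a - b) * q' + p' * (c - d) by ring.
  by rewrite !mxderivM [mxderiv X (_ + _)]linearD [mxderiv Y (_ + _)]linearD /=
    !mxderivM aux Hp Hq.
Qed.
End Derivation.

Lemma poly_eq_inj (K : idomainType) (t : nat -> K) (c d : {poly K}) :
  injective t -> (forall k, c.[t k] = d.[t k]) -> c = d.
Proof.
move=> t_inj cd; apply/eqP; rewrite -subr_eq0; apply/eqP.
apply: (@roots_geq_poly_eq0 _ _ [seq t k | k <- iota 0 (size (c - d))]).
- by apply/allP => _ /mapP[k _ ->]; rewrite rootE hornerD hornerN cd subrr.
- by rewrite map_inj_uniq ?iota_uniq.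
- by rewrite size_map size_iota.
Qed.

Lemma poly_eq_eval (K : numDomainType) (c d : {poly K}) :
  (forall k : nat, c.[k%:R] = d.[k%:R]) -> c = d.
Proof. by apply: poly_eq_inj => i j /eqP; rewrite eqr_nat => /eqP. Qed.

(** * Polynomial maps, Zariski closures and the tangent space at the identity *)

Section LieAlgebra.
Import mpoly.
Variables (K : numClosedFieldType) (n : nat).
Implicit Types (f p q : mxpolynomial K n) (X Y h : 'M[K]_n) (G : set 'M[K]_n).

Definition polyfun (u : 'M[K]_n -> K) := exists f, forall X, mxeval f X = u X.

Lemma polyfun_cst c : polyfun (fun=> c).
Proof. by exists (mpoly.mpolyC _ c) => X; rewrite mxevalC. Qed.

Lemma polyfun_entry i j : polyfun (fun X => X i j).
Proof. by exists (varmx K n i j) => X; rewrite mxeval_gen. Qed.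

Lemma polyfunD u v : polyfun u -> polyfun v -> polyfun (fun X => u X + v X).
Proof. by move=> [p Hp] [q Hq]; exists (p + q) => X; rewrite mxevalD Hp Hq. Qed.

Lemma polyfunM u v : polyfun u -> polyfun v -> polyfun (fun X => u X * v X).
Proof. by move=> [p Hp] [q Hq]; exists (p * q) => X; rewrite mxevalM Hp Hq. Qed.

Lemma polyfun_sum (I : Type) (s : seq I) (u : I -> 'M[K]_n -> K) :
  (forall i, polyfun (u i)) -> polyfun (fun X => \sum_(i <- s) u i X).
Proof.
move=> Hu; elim: s => [|i s IH].
  by have [f Hf] := polyfun_cst 0; exists f => X; rewrite big_nil.
by have [f Hf] := polyfunD (Hu i) IH; exists f => X; rewrite big_cons.
Qed.

Lemma polyfun_prod (I : Type) (s : seq I) (u : I -> 'M[K]_n -> K) :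
  (forall i, polyfun (u i)) -> polyfun (fun X => \prod_(i <- s) u i X).
Proof.
move=> Hu; elim: s => [|i s IH].
  by have [f Hf] := polyfun_cst 1; exists f => X; rewrite big_nil.
by have [f Hf] := polyfunM (Hu i) IH; exists f => X; rewrite big_cons.
Qed.

Lemma mxeval_ind (P : ('M[K]_n -> K) -> Prop) :
    (forall c, P (fun=> c)) -> (forall i j, P (fun X => X i j)) ->
    (forall u v, P u -> P v -> P (fun X => u X + v X)) ->
    (forall u v, P u -> P v -> P (fun X => u X * v X)) ->
  forall f, P (mxeval f).
Proof.
move=> PC PX PD PM; apply: mxpoly_ind => [c|i j|p q Hp Hq|p q Hp Hq].
- by rewrite (_ : mxeval _ = fun=> c) //; apply/funext => X; rewrite mxevalC.
- rewrite (_ : mxeval _ = fun X => X i j) //; apply/funext => X.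
  exact: mxeval_gen.
- rewrite (_ : mxeval _ = fun X => mxeval p X + mxeval q X); first exact: PD.
  by apply/funext => X; rewrite mxevalD.
- rewrite (_ : mxeval _ = fun X => mxeval p X * mxeval q X); first exact: PM.
  by apply/funext => X; rewrite mxevalM.
Qed.

Definition polymap (Y : 'M[K]_n -> 'M[K]_n) :=
  forall i j, polyfun (fun X => Y X i j).

Lemma polymap_cst A : polymap (fun=> A).
Proof. by move=> i j; apply: polyfun_cst. Qed.

Lemma polymap_id : polymap id.
Proof. exact: polyfun_entry. Qed.

Lemma polymapM V W : polymap V -> polymap W -> polymap (fun X => V X *m W X).
Proof.
move=> HV HW i j; have [f Hf] : polyfun (fun X => \sum_k V X i k * W X k j).
  by apply: polyfun_sum => k; apply: polyfunM.
by exists f => X; rewrite Hf mxE.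
Qed.

Lemma polyfun_comp f V : polymap V -> polyfun (fun X => mxeval f (V X)).
Proof.
move=> HV; apply: (mxeval_ind (P := fun u => polyfun (fun X => u (V X)))).
- exact: polyfun_cst.
- exact: HV.
- by move=> u v; apply: polyfunD.
- by move=> u v; apply: polyfunM.
Qed.

Lemma polyfun_det m (V : 'M[K]_n -> 'M[K]_m) :
  (forall i j, polyfun (fun X => V X i j)) -> polyfun (fun X => \det (V X)).
Proof.
move=> HV; apply: polyfun_sum => s; apply: polyfunM; first exact: polyfun_cst.
exact: polyfun_prod.
Qed.

Lemma polyfunX u d : polyfun u -> polyfun (fun X => u X ^+ d).
Proof.
move=> Hu; elim: d => [|d IH]; first exact: polyfun_cst.
have [f Hf] := polyfunM Hu IH; exists f => X.
by rewrite exprS Hf.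
Qed.

(** The inverse is the adjugate over the determinant, so a power of the determinant clears
    denominators. This handles inverses in Zariski closures of groups. *)
Lemma polyfun_inv f : exists d q, forall X, X \in unitmx ->
  mxeval q X = \det X ^+ d * mxeval f (invmx X).
Proof.
have pdet : polyfun determinant by apply: polyfun_det; apply: polyfun_entry.
apply: (mxeval_ind (P := fun u => exists d q, forall X, X \in unitmx ->
  mxeval q X = \det X ^+ d * u (invmx X))) => [c|i j|u v|u v].
- have [q Hq] := polyfun_cst c; exists 0, q => X _; by rewrite Hq expr0 mul1r.
- have [q Hq] : polyfun (fun X => (\adj X) i j).
    have [q Hq] : polyfun (fun X => cofactor X j i).
      apply: polyfunM; first exact: polyfun_cst.
      apply: polyfun_det => k l.
      have [q Hq] := polyfun_entry (lift j k) (lift i l).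
      by exists q => X; rewrite Hq !mxE.
    by exists q => X; rewrite Hq mxE.
  exists 1%N, q => X uX; rewrite Hq expr1 /invmx uX [X in _ * X]mxE mulrA mulfV ?mul1r //.
  by rewrite unitmxE unitfE in uX.
- move=> [d1 [q1 H1]] [d2 [q2 H2]].
  have [q Hq] := polyfunD
    (polyfunM (polyfunX d2 pdet) (ex_intro _ q1 (fun=> erefl)))
    (polyfunM (polyfunX d1 pdet) (ex_intro _ q2 (fun=> erefl))).
  exists (d1 + d2)%N, q => X uX; rewrite Hq H1 // H2 // exprD; ring.
- move=> [d1 [q1 H1]] [d2 [q2 H2]].
  have [q Hq] := polyfunM (ex_intro _ q1 (fun=> erefl)) (ex_intro _ q2 (fun=> erefl)).
  exists (d1 + d2)%N, q => X uX; rewrite Hq H1 // H2 // exprD; ring.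
Qed.

Lemma zariski_closure_sub (A : set 'M[K]_n) : (A `<=` zariski_closure A)%classic.
Proof. by move=> X AX f If; apply: If. Qed.

Lemma zariski_closure_closed (A : set 'M[K]_n) : zariski_closed (zariski_closure A).
Proof. by exists (vanishing_ideal A). Qed.

Lemma zariski_closure_min (A Z : set 'M[K]_n) :
  zariski_closed Z -> (A `<=` Z)%classic -> (zariski_closure A `<=` Z)%classic.
Proof. by move=> [S ->] AZ X AX f Sf; apply: AX => Y /AZ; apply. Qed.

Lemma polyfun_closure (u : 'M[K]_n -> K) (A : set 'M[K]_n) X :
  polyfun u -> (forall Y, A Y -> u Y = 0) -> zariski_closure A X -> u X = 0.
Proof. by move=> [f uE] A0 /(_ f); rewrite -uE; apply=> Y /A0; rewrite uE. Qed.

Lemma polymap_closure (Y : 'M[K]_n -> 'M[K]_n) (A B : set 'M[K]_n) X :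
    polymap Y -> (forall Z, A Z -> zariski_closure B (Y Z)) ->
  zariski_closure A X -> zariski_closure B (Y X).
Proof.
move=> HY AB AX f If; apply: (polyfun_closure (polyfun_comp f HY) _ AX).
by move=> Z /AB /(_ f If).
Qed.

Local Notation evmx M t := (map_mx (horner^~ t) M).

Lemma dmx_curve f q (M N : 'M[{poly K}]_n) t :
    (forall s, mxeval f (evmx M s) = mxeval q (evmx N s)) ->
  dmx f (evmx M t) (evmx (map_mx (@deriv _) M) t) =
  dmx q (evmx N t) (evmx (map_mx (@deriv _) N) t).
Proof.
move=> fq; have [c Hc] := mxeval_curve f M; have [d Hd] := mxeval_curve q N.
have [_ <-] := Hc t; have [_ <-] := Hd t.
by rewrite (@poly_eq_eval _ c d) // => k; rewrite (Hc _).1 (Hd _).1.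
Qed.

Definition mxline X Y : 'M[{poly K}]_n := map_mx polyC X + 'X *: map_mx polyC Y.

Lemma mxline_eval X Y t : evmx (mxline X Y) t = X + t *: Y.
Proof. by apply/matrixP => i j; rewrite !mxE !hornerE. Qed.

Lemma mxline_deriv X Y t : evmx (map_mx (@deriv _) (mxline X Y)) t = Y.
Proof.
apply/matrixP => i j.
by rewrite !mxE derivD derivM derivX !derivC !hornerE.
Qed.

(** A differential depends only on the values along a line. With one polynomial being the other
    composed with a translation or a conjugation, this spares differentiating the composite. *)
Lemma dmx_line f q X Y A B :
    (forall s, mxeval f (X + s *: Y) = mxeval q (A + s *: B)) ->
  dmx f X Y = dmx q A B.
Proof.
move=> fq; have := @dmx_curve f q (mxline X Y) (mxline A B) 0.
rewrite !mxline_deriv !mxline_eval !scale0r !addr0; apply=> s.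
by rewrite !mxline_eval.
Qed.

Lemma Lie_dmx G X f : Lie G X -> vanishing_ideal G f -> dmx f 1%:M X = 0.
Proof. by move=> + If => /(_ f If). Qed.

Lemma Lie_linear G a X Y : Lie G X -> Lie G Y -> Lie G (a *: X + Y).
Proof.
move=> HX HY f If; rewrite -/(dmx f 1%:M (a *: X + Y)) dmx_linear.
by rewrite (Lie_dmx HX If) (Lie_dmx HY If) mulr0 addr0.
Qed.

Lemma Lie0 G : Lie G 0.
Proof.
move=> f If; have /eqP := dmx_linear f 1%:M 1 0 0.
by rewrite scale1r addr0 mul1r -[X in X == _]addr0 (inj_eq (addrI _)) eq_sym => /eqP.
Qed.

Lemma LieZ G a X : Lie G X -> Lie G (a *: X).
Proof. by move=> HX; rewrite -[a *: X]addr0; apply: Lie_linear => //; apply: Lie0. Qed.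

Lemma LieD G X Y : Lie G X -> Lie G Y -> Lie G (X + Y).
Proof. by move=> HX HY; rewrite -[X]scale1r; apply: Lie_linear. Qed.

Section Group.
Variable G : set 'M[K]_n.
Hypothesis gG : subgroup G.

Lemma subgroup1 : G 1%:M. Proof. by case: gG. Qed.
Lemma subgroupM g h : G g -> G h -> G (g *m h). Proof. by case: gG => ? ? H ?; apply: H. Qed.
Lemma subgroupV g : G g -> G (invmx g). Proof. by case: gG => ? ? ? H; apply: H. Qed.
Lemma subgroup_unit g : G g -> g \in unitmx. Proof. by case: gG => H ? ? ?; apply: H. Qed.

(** Left translation by [h] preserves [G], hence its ideal, and carries the tangent vector [X] at
    the identity to [h *m X] at [h]. *)
Lemma Lie_translate X f h : Lie G X -> vanishing_ideal G f -> G h -> dmx f h (h *m X) = 0.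
Proof.
move=> LX If Gh.
have [q Hq] := polyfun_comp f (polymapM (polymap_cst h) polymap_id).
rewrite -(@dmx_line q f 1%:M X) => [|s]; last by rewrite Hq mulmxDr mulmx1 -scalemxAr.
by apply: Lie_dmx LX _ => g Gg; rewrite Hq; apply: If; apply: subgroupM.
Qed.

Lemma mxderiv_ideal X f : Lie G X -> vanishing_ideal G f -> vanishing_ideal G (mxderiv X f).
Proof. by move=> LX If h Gh; rewrite mxeval_mxderiv; apply: Lie_translate. Qed.

Lemma Lie_of_mxderiv X :
  (forall f, vanishing_ideal G f -> mxeval (mxderiv X f) 1%:M = 0) -> Lie G X.
Proof. by move=> HX f /HX; rewrite mxeval_mxderiv mul1mx. Qed.

(** The derivations of [X] and [Y] preserve the ideal of [G], hence so does their commutator,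
    identified by [mxderiv_bracket]. *)
Lemma Lie_bracket X Y : Lie G X -> Lie G Y -> Lie G (X *m Y - Y *m X).
Proof.
move=> LX LY; apply: Lie_of_mxderiv => f If.
rewrite -mxderiv_bracket -scaleN1r mxevalD mxevalZ.
have DD Z W : Lie G Z -> Lie G W -> mxeval (mxderiv Z (mxderiv W f)) 1%:M = 0.
  by move=> LZ LW; apply: (mxderiv_ideal LZ (mxderiv_ideal LW If)); apply: subgroup1.
have sub0 (a b : K) : a = 0 -> b = 0 -> a + -1 * b = 0.
  by move=> -> ->; rewrite mulr0 addr0.
by apply: sub0; apply: DD.
Qed.

Lemma Lie_Ad g X : G g -> Lie G X -> Lie G (Ad g X).
Proof.
move=> Gg LX f If.
have [q Hq] := polyfun_comp f
  (polymapM (polymapM (polymap_cst g) polymap_id) (polymap_cst (invmx g))).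
rewrite -/(dmx f 1%:M (Ad g X)) -(@dmx_line q f 1%:M X) => [|s].
  apply: Lie_dmx LX _ => h Gh; rewrite Hq; apply: If.
  by apply: subgroupM; [apply: subgroupM|apply: subgroupV].
rewrite Hq mulmxDr mulmxDl mulmx1 mulmxV ?subgroup_unit //.
by rewrite /Ad -scalemxAr -scalemxAl.
Qed.

End Group.

End LieAlgebra.

(** * Zariski closures of groups *)

Section Groups.
Local Open Scope classical_set_scope.
Variables (K : numClosedFieldType) (n : nat).
Implicit Types (X Y g h : 'M[K]_n) (G H S T : set 'M[K]_n).

Lemma subgroup_GL : subgroup (@GL K n).
Proof.
split=> //; first exact: unitmx1.
- by move=> g h; rewrite /GL /= unitmx_mul => -> ->.
- by move=> g; rewrite /GL /= unitmx_inv.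
Qed.

Lemma subgroup_trivial : subgroup [set (1%:M : 'M[K]_n)].
Proof.
split=> [_ ->|//|_ _ -> ->|_ ->]; first exact: unitmx1.
  by rewrite /= mul1mx.
by rewrite /= invmx1.
Qed.

(** Products are treated one factor at a time: first with the right factor in [T] ([clR]), then in
    its closure ([clL]). For inverses, [polyfun_inv] gives a polynomial vanishing on [T], and the
    determinant power is nonzero at [g]. *)
Lemma subgroup_closure T : subgroup T -> subgroup (zariski_closure T `&` @GL K n).
Proof.
move=> gT.
have clR g h : zariski_closure T g -> T h -> zariski_closure T (g *m h).
  move=> Tg Th; apply: (polymap_closure (polymapM (@polymap_id _ _) (polymap_cst h)) _ Tg).
  by move=> Z TZ; apply: zariski_closure_sub; apply: subgroupM.
have clL g h : zariski_closure T g -> zariski_closure T h -> zariski_closure T (g *m h).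
  move=> Tg Th; apply: (polymap_closure (polymapM (polymap_cst g) (@polymap_id _ _)) _ Th).
  by move=> Z TZ; apply: clR.
split=> [g []//||g h [Tg ug] [Th uh]|g [Tg ug]].
- by split; [apply: zariski_closure_sub; apply: subgroup1|apply: unitmx1].
- by split; [apply: clL|case: subgroup_GL => _ _ H _; apply: H].
- split; last by case: subgroup_GL => _ _ _ H; apply: H.
  move=> f If; have [d [q Hq]] := polyfun_inv f.
  have : mxeval q g = 0.
    apply: Tg => h Th; rewrite Hq ?(subgroup_unit gT) // If ?mulr0 //.
    exact: subgroupV.
  move/eqP; rewrite Hq // mulf_eq0 expf_eq0 => /orP[/andP[_]|/eqP //].
  by move: ug; rewrite /GL /= unitmxE unitfE => /negbTE ->.
Qed.

Lemma generated_sub S : S `<=` generated S.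
Proof. by move=> X SX H _; apply. Qed.

Lemma generated_min S H : subgroup H -> S `<=` H -> generated S `<=` H.
Proof. by move=> gH SH X; apply. Qed.

Lemma subgroup_generated S : S `<=` @GL K n -> subgroup (generated S).
Proof.
move=> SGL; split=> [X|H gH _|g h Sg Sh H gH SH|g Sg H gH SH].
- by apply; first exact: subgroup_GL.
- exact: subgroup1.
- by apply: subgroupM => //; [apply: Sg|apply: Sh].
- by apply: subgroupV => //; apply: Sg.
Qed.

Lemma subgroup_centralizer S :
  subgroup [set g | g \in unitmx /\ forall s, S s -> g *m s = s *m g].
Proof.
split=> [g []//||g h [ug cg] [uh ch]|g [ug cg]] /=.
- by split=> [|s _]; rewrite ?unitmx1 // mul1mx mulmx1.
- split=> [|s Ss]; first by rewrite unitmx_mul ug.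
  by rewrite -mulmxA ch // !mulmxA cg.
- split=> [|s Ss]; first by rewrite unitmx_inv.
  apply: (can_inj (mulKmx ug)); rewrite mulKVmx //.
  by rewrite mulmxA cg // mulmxK.
Qed.

(** Two passes through centralizers: the generated group first centralizes [S], and then itself. *)
Lemma generated_commute S : S `<=` @GL K n ->
    (forall s t, S s -> S t -> s *m t = t *m s) ->
  forall g h, generated S g -> generated S h -> g *m h = h *m g.
Proof.
move=> SGL comS g h Sg Sh.
have cS x s : generated S x -> S s -> x *m s = s *m x.
  move=> Sx; suff sub : generated S `<=`
      [set g | g \in unitmx /\ forall s, S s -> g *m s = s *m g].
    by have [_ H] := sub x Sx; apply: H.
  apply: generated_min; first exact: subgroup_centralizer.
  by move=> t St; split=> [|u Su]; [apply: SGL|apply: comS].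
suff sub : generated S `<=`
    [set g | g \in unitmx /\ forall s, generated S s -> g *m s = s *m g].
  by have [_ H] := sub g Sg; apply: H.
apply: generated_min; first exact: subgroup_centralizer.
by move=> t St; split=> [|u Su]; [apply: SGL|rewrite cS].
Qed.

(** For fixed [Y] the entries of XY - YX are polynomial in X, so commutation extends to the closure
    in one variable, then in the other. *)
Lemma closure_commute T :
    (forall g h, T g -> T h -> g *m h = h *m g) ->
  forall g h, zariski_closure T g -> zariski_closure T h -> g *m h = h *m g.
Proof.
move=> comT.
have pc Y i j : polyfun (fun X => (X *m Y) i j + -1 * (Y *m X) i j).
  apply: polyfunD; last apply: polyfunM (@polyfun_cst _ _ (-1)) _.
    exact: (polymapM (@polymap_id _ _) (polymap_cst Y)).
  exact: (polymapM (polymap_cst Y) (@polymap_id _ _)).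
have com1 Y g : (forall x, T x -> x *m Y = Y *m x) -> zariski_closure T g ->
    g *m Y = Y *m g.
  move=> cY Tg; apply/matrixP => i j; apply/eqP; rewrite -subr_eq0 -mulN1r; apply/eqP.
  by apply: (polyfun_closure (pc Y i j) _ Tg) => x Tx; rewrite cY // mulN1r subrr.
move=> g h Tg Th; apply: (com1 _ _ _ Tg) => x Tx; apply/esym.
apply: (com1 _ _ _ Th) => y Ty.
exact: comT.
Qed.

Lemma abelian_solvable H : subgroup H ->
  (forall g h, H g -> H h -> g *m h = h *m g) -> solvable_group H.
Proof.
move=> gH comH; exists 1%N; apply/seteqP; split=> /= [X|X ->].
  apply; first exact: subgroup_trivial.
  move=> _ [g [h [Hg Hh ->]]].
  rewrite (comH g h) // mulmxK ?mulmxV ?(subgroup_unit gH) //.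
by move=> L gL _; apply: subgroup1.
Qed.

Lemma Ad1 g : g \in unitmx -> Ad g 1%:M = 1%:M.
Proof. by move=> ug; rewrite /Ad mulmx1 mulmxV. Qed.

Lemma AdM g X Y : g \in unitmx -> Ad g (X *m Y) = Ad g X *m Ad g Y.
Proof. by move=> ug; rewrite /Ad !mulmxA mulmxKV. Qed.

Lemma AdVK g X : g \in unitmx -> Ad g (Ad (invmx g) X) = X.
Proof. by move=> ug; rewrite /Ad invmxK !mulmxA mulmxV // mul1mx mulmxK. Qed.

Lemma AdK g X : g \in unitmx -> Ad (invmx g) (Ad g X) = X.
Proof. by move=> ug; rewrite /Ad invmxK !mulmxA mulVmx // mul1mx mulmxKV. Qed.

Lemma Ad_unit g X : g \in unitmx -> X \in unitmx -> Ad g X \in unitmx.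
Proof. by move=> ug uX; rewrite /Ad !unitmx_mul unitmx_inv ug uX. Qed.

Lemma AdV g X : g \in unitmx -> X \in unitmx -> Ad g (invmx X) = invmx (Ad g X).
Proof.
move=> ug uX; apply: (can_inj (mulKmx (Ad_unit ug uX))).
by rewrite mulmxV ?Ad_unit // -AdM // mulmxV // Ad1.
Qed.

Lemma generated_Ad S g : g \in unitmx -> S `<=` @GL K n ->
  (forall s, S s -> S (Ad g s)) -> forall y, generated S y -> generated S (Ad g y).
Proof.
move=> ug SGL SAd y Sy; have gS := subgroup_generated SGL.
suff sub : generated S `<=` [set y | y \in unitmx /\ generated S (Ad g y)].
  by have [] := sub y Sy.
apply: generated_min => [|s Ss]; last first.
  by split; [apply: SGL|apply: generated_sub; apply: SAd].
split=> /= [z []//||a b [ua Sa] [ub Sb]|a [ua Sa]].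
- by split; [apply: unitmx1|rewrite Ad1 //; apply: (subgroup1 gS)].
- by split; [rewrite unitmx_mul ua|rewrite AdM //; apply: (subgroupM gS)].
- by split; [rewrite unitmx_inv|rewrite AdV //; apply: (subgroupV gS)].
Qed.

End Groups.

(** * Spectral idempotents and weights *)

Section Spectral.
Variable K : numClosedFieldType.

Section Idempotents.
Variables (L : seq K) (k : K -> nat).
Hypothesis uL : uniq L.
Let p l : {poly K} := ('X - l%:P) ^+ k l.

Lemma coprimep_XsubC_exp l m : l != m -> coprimep (p l) (p m).
Proof.
move=> lm; apply: coprimep_expl; apply: coprimep_expr; apply: coprimep_XsubC2.
by rewrite subr_eq0 eq_sym.
Qed.

Lemma coprimep_prod_seq (q : {poly K}) s :
  {in s, forall m, coprimep q (p m)} -> coprimep q (\prod_(m <- s) p m).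
Proof.
elim: s => [|m s IH] H; first by rewrite big_nil coprimep1.
rewrite big_cons coprimepMr H ?mem_head // IH // => x xs.
by apply: H; rewrite inE xs orbT.
Qed.

Lemma dvdp_prod_coprime (q : {poly K}) :
  {in L, forall l, p l %| q} -> \prod_(l <- L) p l %| q.
Proof.
elim: L uL => [|m s IH] /=; first by rewrite big_nil dvd1p.
move=> /andP[ms us] H; rewrite big_cons Gauss_dvdp; last first.
  apply: coprimep_prod_seq => x xs; apply: coprimep_XsubC_exp.
  by apply: contraNneq ms => ->.
by rewrite H ?mem_head // IH // => x xs; apply: H; rewrite inE xs orbT.
Qed.

(** Chinese remainder theorem: [E l] is 1 modulo [p l] and 0 modulo the other factors, so the [E l]
    are orthogonal idempotents modulo the product. *)
Lemma poly_idempotents : exists E : K -> {poly K},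
  [/\ \prod_(l <- L) p l %| \sum_(l <- L) E l - 1,
      {in L, forall l, \prod_(l <- L) p l %| p l * E l} &
      {in L &, forall l m, l != m -> \prod_(l <- L) p l %| E l * E m}].
Proof.
pose q l := \prod_(m <- L | m != l) p m.
have pq l : l \in L -> \prod_(m <- L) p m = p l * q l by move=> lL; rewrite (bigD1_seq l).
have /choice[E HE] : forall l, exists E, p l %| E - 1 /\ q l %| E.
  move=> l; have : coprimep (p l) (q l).
    rewrite /q -big_filter; apply: coprimep_prod_seq => m.
    by rewrite mem_filter => /andP[ml _]; apply: coprimep_XsubC_exp; rewrite eq_sym.
  case/Bezout_eq1_coprimepP => -[u v] /= uv; exists (v * q l); split.
    by rewrite -uv opprD addrCA subrr addr0 dvdpNr dvdp_mull.
  exact: dvdp_mull.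
have qp l m : l \in L -> l != m -> p l %| q m.
  by move=> lL lm; rewrite /q -big_filter (bigD1_seq l) ?filter_uniq ?dvdp_mulr //=
    mem_filter lm.
exists E; split=> [|l lL|l m lL mL lm].
- apply: dvdp_prod_coprime => m mL; rewrite (bigD1_seq m) //= addrAC.
  rewrite dvdp_addr ?(HE m).1 //; apply: (big_ind (fun q => p m %| q)) => [|a b|l lm]; first exact: dvdp0.
    exact: dvdp_add.
  by apply: (dvdp_trans (qp _ _ mL _) (HE l).2); rewrite eq_sym.
- by rewrite (pq l) // dvdp_mul // (HE l).2.
- rewrite (pq l) // mulrC dvdp_mul ?(HE l).2 //.
  exact: (dvdp_trans (qp _ _ lL lm) (HE m).2).
Qed.

End Idempotents.

Variable n' : nat.
Let n := n'.+1.
Implicit Types (X Y g : 'M[K]_n) (L : seq K) (e : K -> 'M[K]_n).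

(** For [l] in [L], [e l] is the projector onto the generalised eigenspace of [X] for [l]. The last
    clause, commutation with the commutant of [X], stands in for [e l] being a polynomial in [X]. *)
Definition spectral X L e :=
  [/\ uniq L, \sum_(l <- L) e l = 1,
      {in L &, forall l m, e l * e m = if l == m then e l else 0},
      {in L, forall l, exists N, (X - l%:M) ^+ N * e l = 0} &
      {in L, forall l Y, X * Y = Y * X -> e l * Y = Y * e l}].

(** The idempotents modulo the characteristic polynomial are evaluated at [X]; Cayley-Hamilton makes
    the congruences equalities. *)
Lemma spectral_exists X : exists L e, spectral X L e.
Proof.
have [r Hr] := closed_field_poly_normal (char_poly X).
rewrite (monicP (char_poly_monic X)) scale1r in Hr.
pose L := undup r; pose k l := count_mem l r.
have [E [E1 E2 E3]] := @poly_idempotents L k (undup_uniq r).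
have PX : \prod_(l <- L) ('X - l%:P) ^+ k l = char_poly X.
  by rewrite Hr prodr_undup_exp_count.
have kill q : \prod_(l <- L) ('X - l%:P) ^+ k l %| q -> horner_mx X q = 0.
  by rewrite PX => /dvdpP[u ->]; rewrite rmorphM /= Cayley_Hamilton mulr0.
have sum1 : \sum_(l <- L) horner_mx X (E l) = 1.
  rewrite -rmorph_sum; apply/eqP; rewrite -subr_eq0; apply/eqP.
  by rewrite -[X in _ - X](rmorph1 (horner_mx X)) -rmorphB /= kill.
have orth l m : l \in L -> m \in L -> l != m -> horner_mx X (E l) * horner_mx X (E m) = 0.
  by move=> lL mL lm; rewrite -rmorphM /= kill ?E3.
exists L, (fun l => horner_mx X (E l)); split=> [||l m lL mL|l lL|l lL Y XY].
- exact: undup_uniq.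
- exact: sum1.
- case: eqP => [<-|/eqP]; last exact: orth.
  rewrite -[RHS]mulr1 -sum1 mulr_sumr (bigD1_seq l) ?undup_uniq //=.
  rewrite [X in _ + X]big_seq_cond [X in _ + X]big1 ?addr0 //.
  by move=> i /andP[iL il]; apply: orth; rewrite // eq_sym.
- exists (k l); have := kill _ (E2 l lL).
  by rewrite rmorphM rmorphXn rmorphB /= horner_mx_X horner_mx_C.
- exact: comm_horner_mx.
Qed.

(** The functional calculus: [h] applied to the semisimple part of [X]. *)
Definition fcalc L e (h : K -> K) : 'M[K]_n := \sum_(l <- L) h l *: e l.

Lemma spectral_fcalc X L e h m :
  spectral X L e -> m \in L -> fcalc L e h * e m = h m *: e m.
Proof.
move=> [uL _ orth _ _] mL; rewrite /fcalc mulr_suml (bigD1_seq m) //=.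
rewrite -scalerAl orth // eqxx big_seq_cond big1 ?addr0 // => l /andP[lL lm].
by rewrite -scalerAl orth // (negbTE lm) scaler0.
Qed.

Lemma fcalcM X L e h1 h2 : spectral X L e ->
  fcalc L e h1 * fcalc L e h2 = fcalc L e (fun l => h1 l * h2 l).
Proof.
move=> sp; rewrite {2}/fcalc mulr_sumr; apply: eq_big_seq => m mL.
by rewrite -scalerAr (spectral_fcalc _ sp mL) scalerA mulrC.
Qed.

Lemma fcalc_eq1 X L e h : spectral X L e -> {in L, forall l, h l = 1} -> fcalc L e h = 1.
Proof.
move=> [_ <- _ _ _] h1; apply: eq_big_seq => l lL.
by rewrite h1 // scale1r.
Qed.

Lemma spectral_commute X L e h Y : spectral X L e ->
  X * Y = Y * X -> fcalc L e h * Y = Y * fcalc L e h.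
Proof.
move=> [_ _ _ _ com] XY; rewrite /fcalc mulr_suml mulr_sumr; apply: eq_big_seq => l lL.
by rewrite -scalerAl -scalerAr com.
Qed.

Lemma AdMr g X Y : g \in unitmx -> Ad g (X * Y) = Ad g X * Ad g Y.
Proof. exact: AdM. Qed.

Lemma AdXr g X k : g \in unitmx -> Ad g (X ^+ k) = Ad g X ^+ k.
Proof.
move=> ug; elim: k => [|k IH]; first by rewrite !expr0; apply: Ad1.
by rewrite !exprS AdMr // IH.
Qed.

Lemma fcalc_unit X L e h :
  spectral X L e -> {in L, forall l, h l != 0} -> fcalc L e h \in unitmx.
Proof.
move=> sp h0; have : fcalc L e h * fcalc L e (fun l => (h l)^-1) = 1.
  by rewrite (fcalcM _ _ sp) (fcalc_eq1 sp) // => l lL; rewrite mulfV ?h0.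
by move=> /mulmx1_unit[].
Qed.

Lemma fcalc_Ad g L e h : Ad g (fcalc L e h) = fcalc L (fun l => Ad g (e l)) h.
Proof.
rewrite /fcalc /Ad mulmx_sumr mulmx_suml; apply: eq_bigr => l _.
by rewrite -scalemxAr -scalemxAl.
Qed.

Lemma spectral_conj X L e g : g \in unitmx -> spectral X L e ->
  spectral (Ad g X) L (fun l => Ad g (e l)).
Proof.
move=> ug [uL s1 orth nil com].
split=> // [|l m lL mL|l lL|l lL Y XY].
- by rewrite /Ad -mulmx_suml -mulmx_sumr s1; apply: Ad1.
- by rewrite -AdMr // orth //; case: ifP => // _; rewrite /Ad mulmx0 mul0mx.
- have [N HN] := nil l lL; exists N.
  have -> : Ad g X - l%:M = Ad g (X - l%:M).
    by rewrite /Ad mulmxBr mulmxBl -[l%:M]scalemx1 -scalemxAr -scalemxAl mulmx1 mulmxV.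
  by rewrite -AdXr // -AdMr // HN /Ad mulmx0 mul0mx.
- move: XY; rewrite -[Y](AdVK _ ug) -!AdMr // => /(can_inj (fun Z => AdK Z ug)) XZ.
  by congr Ad; apply: com.
Qed.

End Spectral.

(** * Generalised eigenvectors and invariant subspaces, in arbitrary dimension *)

Section GeneralizedEigen.
Variables (K : fieldType) (V : lmodType K) (D : {linear V -> V}) (I : V -> Prop).
Hypothesis I0 : I 0.
Hypothesis Ilin : forall a x y, I x -> I y -> I (a *: x + y).
Hypothesis ID : forall x, I x -> I (D x).

Definition shift a x := D x - a *: x.

Definition gen_eigen a x := exists k, iter k (shift a) x = 0.

Lemma shift_linear a : linear (shift a).
Proof.
move=> b x y; rewrite /shift linearP !scalerDr opprD addrACA scalerN !scalerA.
by rewrite mulrC.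
Qed.

HB.instance Definition _ a := GRing.isLinear.Build K V V *:%R (shift a) (@shift_linear a).

Lemma iter_shift_linear k a : linear (iter k (shift a)).
Proof. by elim: k => [|k IH] b x y; rewrite ?iterS ?IH ?linearP. Qed.

HB.instance Definition _ k a :=
  GRing.isLinear.Build K V V *:%R (iter k (shift a)) (@iter_shift_linear k a).

Lemma shiftC a b x : shift a (shift b x) = shift b (shift a x).
Proof.
have E c d : shift c (shift d x) = D (D x) - d *: D x - c *: D x + (c * d) *: x.
  rewrite {1}/shift /shift [D (_ - _)]raddfB /= [D (_ *: _)]linearZ /= scalerBr scalerA opprB.
  by rewrite addrA addrAC.
by rewrite !E mulrC; congr (_ + _); rewrite addrAC.
Qed.

Lemma iter_shiftC k a b x : iter k (shift a) (shift b x) = shift b (iter k (shift a) x).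
Proof. by elim: k => //= k ->; rewrite shiftC. Qed.

Lemma gen_eigenD a x y : gen_eigen a x -> gen_eigen a y -> gen_eigen a (x + y).
Proof.
move=> [k Hk] [l Hl]; exists (k + l)%N; rewrite linearD /= {1}addnC !iterD.
by rewrite Hk Hl !linear0 addr0.
Qed.

Lemma gen_eigen0 a : gen_eigen a 0.
Proof. by exists 0%N. Qed.

Lemma I_scale a x : I x -> I (a *: x).
Proof. by move=> Ix; rewrite -[_ *: _]addr0; apply: Ilin. Qed.

Lemma I_shift a x : I x -> I (shift a x).
Proof. by move=> Ix; rewrite /shift addrC -scaleNr; apply: Ilin => //; apply: ID. Qed.

(** Induction on the exponent killing [x] puts [shift a x] in [I], and (a - b)x is the difference of
    [shift b x] and [shift a x]. *)
Lemma I_shift_inv a b x : a != b -> gen_eigen a x -> I (shift b x) -> I x.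
Proof.
move=> ab [k]; elim: k x => [|k IH] x; first by move=> /= ->.
rewrite iterSr => /IH Hy Ix.
have Iy : I (shift a x) by apply: Hy; rewrite shiftC; apply: I_shift.
have -> : x = (a - b)^-1 *: ((-1) *: shift a x + shift b x).
  rewrite /shift scaleN1r opprB addrA subrK -scalerBl scalerA mulVf ?scale1r //.
  by rewrite subr_eq0.
by apply: I_scale; apply: Ilin.
Qed.

(** Applying [shift b] to the sum lowers the exponent [k] killing the component at [b];
    [I_shift_inv] then recovers the other components, and the one at [b] is what remains. *)
Lemma I_component (u : seq K) (F : K -> V) : uniq u ->
    {in u, forall a, gen_eigen a (F a)} -> I (\sum_(a <- u) F a) ->
  {in u, forall a, I (F a)}.
Proof.
elim: u F => [|b u IH] F //= /andP[bu uu] gF IF.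
have [k Hk] := gF b (mem_head _ _).
elim: k F gF IF Hk => [|k IHk] F gF IF /= Hk.
  rewrite big_cons Hk add0r in IF.
  move=> a; rewrite inE => /orP[/eqP->|au]; first by rewrite Hk.
  by apply: (IH F) => // c cu; apply: gF; rewrite inE cu orbT.
have Ifu a : a \in u -> I (F a).
  move=> au; have ab : a != b by apply: contraNneq bu => <-.
  have aub : a \in b :: u by rewrite inE au orbT.
  apply: (I_shift_inv ab (gF _ aub)).
  apply: (IHk (fun a => shift b (F a))) => // [c cu||].
  - by have [m Hm] := gF c cu; exists m; rewrite iter_shiftC Hm linear0.
  - by rewrite -linear_sum; apply: I_shift.
  - by rewrite -iterSr.
move=> a; rewrite inE => /orP[/eqP->|]; last exact: Ifu.
have -> : F b = (-1) *: (\sum_(a <- u) F a) + \sum_(a <- b :: u) F a.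
  by rewrite big_cons scaleN1r addrCA addNr addr0.
apply: Ilin => //; rewrite big_seq; apply: (big_ind I) => // x y Ix Iy.
by rewrite -[x]scale1r; apply: Ilin.
Qed.

(** An eigenvalue may occur several times in [s], so terms are first grouped by eigenvalue;
    [I_component] then applies to the groups. *)
Lemma I_weights (s : seq (K * V)) (h : K -> K) :
    {in s, forall p, gen_eigen p.1 p.2} -> I (\sum_(p <- s) p.2) ->
  I (\sum_(p <- s) h p.1 *: p.2).
Proof.
move=> gs Is; pose u := undup (map fst s).
pose F a := \sum_(p <- s | p.1 == a) p.2.
have regroup (G : K * V -> V) :
    \sum_(p <- s) G p = \sum_(a <- u) \sum_(p <- s | p.1 == a) G p.
  rewrite (exchange_big_dep xpredT) //= big_seq [RHS]big_seq; apply: eq_bigr => p ps.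
  rewrite big_mkcond (bigD1_seq p.1) ?undup_uniq ?mem_undup ?map_f //= eqxx.
  by rewrite big1 ?addr0 // => a /negbTE; rewrite eq_sym => ->.
have gF : {in u, forall a, gen_eigen a (F a)}.
  move=> a _; rewrite /F big_seq_cond.
  apply: (big_ind (gen_eigen a)) => [||p /andP[ps /eqP <-]]; last exact: gs.
    exact: gen_eigen0.
  exact: gen_eigenD.
rewrite regroup in Is; have IF := I_component (undup_uniq _) gF Is.
have -> : \sum_(p <- s) h p.1 *: p.2 = \sum_(a <- u) h a *: F a.
  rewrite regroup; apply: eq_bigr => a _; rewrite scaler_sumr.
  by apply: eq_bigr => p /eqP ->.
rewrite big_seq; apply: (big_ind I) => // [x y Ix Iy|a au].
  by rewrite -[x]scale1r; apply: Ilin.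
by apply: I_scale; apply: IF.
Qed.

End GeneralizedEigen.

(** * Replicas and multiplicative characters of an element of the Lie algebra *)

Section Weights.
Import mpoly.
Variables (K : numClosedFieldType) (n' : nat).
Let n := n'.+1.
Variables (X : 'M[K]_n) (L : seq K) (e : K -> 'M[K]_n).
Hypothesis sp : spectral X L e.
Implicit Types (f q : mxpolynomial K n) (phi psi : K -> K).

Definition additive_fun phi := forall x y, phi (x + y) = phi x + phi y.
Definition exponential_fun psi := psi 0 = 1 /\ forall x y, psi (x + y) = psi x * psi y.

Local Notation DX := (@mxderiv K n X).

(* Weight vectors simultaneously for X, its replicas [fcalc L e phi] and the
   right translations by [fcalc L e psi]; only X itself need not act diagonally. *)
Definition weight a f :=
  [/\ gen_eigen DX a f,
      forall phi, additive_fun phi -> forall h,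
        mxeval (mxderiv (fcalc L e phi) f) h = phi a * mxeval f h &
      forall psi, exponential_fun psi -> forall h,
        mxeval f (h *m fcalc L e psi) = psi a * mxeval f h].

Lemma weight_cst c : weight 0 (@mpolyC (n * n) K c).
Proof.
split=> [|phi phiD h|psi [psi0 _] h]; last by rewrite !mxevalC psi0 mul1r.
  by exists 1%N; rewrite /= /shift /= mxderivC scale0r subr0.
have -> : phi 0 = 0 by apply: (@addrI _ (phi 0)); rewrite -phiD !addr0.
by rewrite mul0r mxderivC /mxeval meval0.
Qed.

(** By the Leibniz rule, shifting a product by a + b shifts one factor at a time; after k + l shifts
    one factor is exhausted. *)
Lemma gen_eigenM a b f q :
  gen_eigen DX a f -> gen_eigen DX b q -> gen_eigen DX (a + b) (f * q).
Proof.
have shiftM u v : shift DX (a + b) (u * v) = shift DX a u * v + u * shift DX b v.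
  rewrite /shift /= mxderivM scalerDl mulrBl mulrBr -scalerAl -scalerAr opprD.
  by rewrite addrACA.
move=> [k Hk] [l Hl]; exists (k + l)%N.
move: {2}(k + l)%N (leqnn (k + l)) => m.
elim: m k l f q Hk Hl => [|m IH] [|k] [|l] f q Hk Hl; rewrite ?addn0 ?add0n // => klm.
- by rewrite /= in Hk; rewrite Hk mul0r linear0.
- by rewrite /= in Hk; rewrite Hk mul0r linear0.
- by rewrite /= in Hk; rewrite Hk mul0r linear0.
- by rewrite /= in Hl; rewrite Hl mulr0 linear0.
rewrite addSn ltnS in klm.
rewrite addSn iterSr shiftM linearD /= (IH k l.+1) ?add0r -?iterSr //.
by rewrite addnS -addSn (IH k.+1 l) -?iterSr // addSn -addnS.
Qed.

Lemma weightM a b f q : weight a f -> weight b q -> weight (a + b) (f * q).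
Proof.
move=> [Df Pf Sf] [Dq Pq Sq]; split=> [|phi phiD h|psi psiE h].
- exact: gen_eigenM.
- rewrite mxderivM mxevalD !mxevalM Pf // Pq // phiD; ring.
- rewrite !mxevalM Sf // Sq // psiE.2; ring.
Qed.

Local Notation entry Y i j := ((varmx K n *m map_mx (@mpolyC (n * n) K) Y) i j).

(** The derivation multiplies the generic matrix by [X] on the right, so [nil] for [e l] becomes the
    generalised eigenvector condition. *)
Lemma weight_entry l i j : l \in L -> weight l (entry (e l) i j).
Proof.
move=> lL; have [_ _ _ nil _] := sp.
have fe h : fcalc L e h *m e l = h l *: e l by exact: spectral_fcalc sp lL.
split=> [|phi phiD h|psi psiE h].
- have [N HN] := nil l lL; exists N.
  suff -> : iter N (shift DX l) (entry (e l) i j) = entry ((X - l%:M) ^+ N * e l) i j.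
    by rewrite HN map_mx0 mulmx0 mxE.
  elim: N {HN} => [|N IH]; first by rewrite expr0 mul1r.
  rewrite iterS IH /shift /= mxderiv_mul exprS -[in RHS]mulrA.
  rewrite [in RHS]mulrBl -scalemx1 -[in RHS]scalerAl mul1r.
  by rewrite map_mxB mulmxBr map_mxZ -scalemxAr !mxE mul_mpolyC.
- by rewrite mxderiv_mul !mxeval_mul fe -scalemxAr mxE.
- by rewrite !mxeval_mul -mulmxA fe -scalemxAr mxE.
Qed.

(** Coordinates split because the [e l] sum to 1, and weights add under products; this is where
    additive [phi] and exponential [psi] are the right functions. *)
Lemma weight_decomposition f : exists s : seq (K * {mpoly K[n * n]}),
  f = \sum_(p <- s) p.2 /\ {in s, forall p, weight p.1 p.2}.
Proof.
elim/mxpoly_ind: f => [c|i j|f q [s [-> ws]] [t [-> wt]]|f q [s [-> ws]] [t [-> wt]]].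
- exists [:: (0, @mpolyC (n * n) K c)]; rewrite big_seq1; split=> // p.
  by rewrite inE => /eqP->; apply: weight_cst.
- exists [seq (l, entry (e l) i j) | l <- L]; rewrite big_map /=; split.
    have [_ s1 _ _ _] := sp.
    have {1}-> : varmx K n = varmx K n *m map_mx (@mpolyC (n * n) K) 1.
      by rewrite map_mx1 mulmx1.
    by rewrite -s1 raddf_sum mulmx_sumr summxE.
  by move=> p /mapP[l lL ->]; apply: weight_entry.
- exists (s ++ t); rewrite big_cat; split=> // p.
  by rewrite mem_cat => /orP[/ws|/wt].
- exists [seq (p.1 + r.1, p.2 * r.2) | p <- s, r <- t]; split.
    rewrite big_allpairs_dep /= mulr_suml; apply: eq_bigr => p _.
    by rewrite mulr_sumr.
  by move=> p /allpairsP[[u v] /= [us vt ->]]; apply: weightM; [apply: ws|apply: wt].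
Qed.

Variable G : set 'M[K]_n.
Hypotheses (gG : subgroup G) (LX : Lie G X).

(** The ideal of [G] is stable under the derivation of [X], so by [I_weights] rescaling weight
    components stays in the ideal. With [h] equal to [phi] or [psi] the sum at the identity is a
    derivative along, or a value at, [fcalc]. *)
Lemma ideal_weights f (h : K -> K) s :
    vanishing_ideal G f -> f = \sum_(p <- s) p.2 ->
    {in s, forall p, weight p.1 p.2} ->
  forall g, G g -> \sum_(p <- s) h p.1 * mxeval p.2 g = 0.
Proof.
move=> If fE ws g Gg.
have : vanishing_ideal G (\sum_(p <- s) h p.1 *: p.2).
  apply: (@I_weights _ _ DX (vanishing_ideal G)) => [x _|a u v Iu Iv x Gx|u Iu|p ps|].
  - by rewrite /mxeval meval0.
  - by rewrite mxevalD mxevalZ Iu // Iv // mulr0 addr0.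
  - exact: mxderiv_ideal.
  - by case: (ws p ps).
  - by rewrite -fE.
move=> /(_ g Gg); rewrite mxeval_sum => Ig; rewrite -[RHS]Ig; apply: eq_bigr => p _.
by rewrite mxevalZ.
Qed.

Lemma Lie_fcalc phi : additive_fun phi -> Lie G (fcalc L e phi).
Proof.
move=> phiD; apply: Lie_of_mxderiv => f If; have [s [fE ws]] := weight_decomposition f.
rewrite fE linear_sum mxeval_sum -[RHS](ideal_weights phi If fE ws (subgroup1 gG)).
by apply: eq_big_seq => p ps; have [_ H _] := ws p ps; apply: H.
Qed.

Lemma closure_fcalc psi : exponential_fun psi -> zariski_closure G (fcalc L e psi).
Proof.
move=> psiE f If; have [s [fE ws]] := weight_decomposition f.
rewrite -[fcalc L e psi]mul1mx fE mxeval_sum.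
rewrite -[RHS](ideal_weights psi If fE ws (subgroup1 gG)).
by apply: eq_big_seq => p ps; have [_ _ H] := ws p ps; apply: H.
Qed.

End Weights.

(** * Exponentials of nilpotent matrices *)

Section NilpotentExponential.
Variables (K : numClosedFieldType) (n' : nat).
Local Notation n := n'.+1.
Implicit Types (X Y g : 'M[K]_n) (G : set 'M[K]_n).

(** The series is cut at [n] terms, which is the full exponential when [X ^+ n = 0]. *)
Definition expmx X : 'M[K]_n := \sum_(k < n) (k`!%:R)^-1 *: X ^+ k.

Definition expcurve X : 'M[{poly K}]_n :=
  \matrix_(i, j) \poly_(k < n) ((k`!%:R)^-1 * (X ^+ k) i j).

Lemma expmx0 : expmx 0 = 1%:M.
Proof.
rewrite /expmx big_ord_recl big1 => [|k _]; last by rewrite expr0n scaler0.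
by rewrite expr0 fact0 invr1 scale1r addr0.
Qed.

Lemma expcurve_eval X t : map_mx (horner^~ t) (expcurve X) = expmx (t *: X).
Proof.
apply/matrixP => i j; rewrite !mxE horner_poly summxE; apply: eq_bigr => k _.
by rewrite exprZn scalerA mxE mulrAC.
Qed.

Lemma expcurve_deriv X : X ^+ n = 0 ->
  map_mx (@deriv _) (expcurve X) = expcurve X *m map_mx polyC X.
Proof.
move=> Xn; apply/matrixP => i j; rewrite !mxE; apply/polyP => k.
rewrite coef_deriv coef_poly coef_sum.
under eq_bigr => l _ do rewrite !mxE coefMC coef_poly.
have XS : (X ^+ k.+1) i j = \sum_l (X ^+ k) i l * X l j by rewrite exprSr mxE.
case: (ltngtP k.+1 n) => [kn|kn|kn].
- under eq_bigr => l _ do rewrite /= -mulrA.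
  rewrite -mulr_sumr -XS -[LHS]mulr_natr mulrAC factS natrM invfM.
  by congr (_ * _); rewrite mulrAC mulVf ?mul1r ?pnatr_eq0.
- by rewrite mul0rn big1 // => l _; rewrite /= mul0r.
(* The top coefficient, where the truncation is felt: it needs [X ^+ n = 0]. *)
- rewrite mul0rn; under eq_bigr => l _ do rewrite /= -mulrA.
  by rewrite -mulr_sumr -XS kn Xn mxE mulr0.
Qed.

(** For [f] in the ideal, the derivative of f(exp(tX)) is again such a function, for [mxderiv X f],
    which is also in the ideal. Hence all Taylor coefficients at 0 vanish, and t = 1 gives the
    claim. *)
Lemma expmx_closure G X : subgroup G -> Lie G X -> X ^+ n = 0 ->
  zariski_closure G (expmx X).
Proof.
move=> gG LX Xn f If.
have coefE0 k : forall q c, vanishing_ideal G q ->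
    (forall t, c.[t] = mxeval q (expmx (t *: X))) -> c`_k = 0.
  elim: k => [|k IH] q c Iq Hc.
    rewrite -horner_coef0 Hc scale0r; apply: Iq.
    by rewrite expmx0; apply: subgroup1.
  have [d Hd] := mxeval_curve q (expcurve X).
  have cd : c = d.
    by apply: poly_eq_eval => r; rewrite Hc (Hd _).1 expcurve_eval.
  have : (c^`())`_k = 0.
    apply: (IH (mxderiv X q)); first exact: mxderiv_ideal.
    move=> t; rewrite mxeval_mxderiv cd (Hd _).2 expcurve_deriv // -expcurve_eval.
    congr (dmx _ _ _); apply/matrixP => i j; rewrite !mxE horner_sum.
    by apply: eq_bigr => l _; rewrite !mxE hornerM hornerC.
  by rewrite coef_deriv => /eqP; rewrite mulrn_eq0 /= => /eqP.
have [c Hc] := mxeval_curve f (expcurve X).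
have c0 : c = 0.
  apply/polyP => k; rewrite coef0; apply: (coefE0 k f c) => // t.
  by rewrite (Hc t).1 expcurve_eval.
by have := (Hc 1).1; rewrite expcurve_eval scale1r c0 horner0.
Qed.

Lemma expmx_conj g X : g \in unitmx -> expmx (Ad g X) = Ad g (expmx X).
Proof.
move=> ug; rewrite /expmx {2}/Ad mulmx_sumr mulmx_suml; apply: eq_bigr => k _.
by rewrite -AdXr // -scalemxAr -scalemxAl.
Qed.

Lemma expmx_commute X Y : X * Y = Y * X -> expmx X * expmx Y = expmx Y * expmx X.
Proof.
move=> XY; have cY k : X ^+ k * Y = Y * X ^+ k by apply/esym/commrX.
rewrite /expmx mulr_suml mulr_sumr; apply: eq_bigr => k _.
rewrite -scalerAl -scalerAr mulr_suml mulr_sumr; congr (_ *: _).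
by apply: eq_bigr => l _; rewrite -scalerAl -scalerAr; congr (_ *: _); apply: commrX.
Qed.

(** The polynomial curve exp(tX) is constant, being 1 at infinitely many points, so its derivative,
    which is then [X], vanishes. *)
Lemma expmx_eq1 X : X ^+ n = 0 -> (forall k : nat, expmx (k%:R *: X) = 1) -> X = 0.
Proof.
move=> Xn eX; have E1 : expcurve X = map_mx polyC 1%:M.
  apply/matrixP => i j; apply: poly_eq_eval => k.
  have := congr1 (fun A : 'M_n => A i j) (eX k).
  by rewrite -expcurve_eval !mxE hornerC.
have := expcurve_deriv Xn; rewrite E1 -map_mxM mul1mx => /matrixP D.
by apply/matrixP => i j; have := D i j; rewrite !mxE derivC => /polyC_inj <-.
Qed.

End NilpotentExponential.

(** * Engel's theorem *)

Section Engel.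
Variables (K : fieldType) (A : falgType K).
Implicit Types (U V L : {vspace A}) (x y z : A).

Lemma expv_eq0 U m k : (m <= k)%N -> (U ^+ m = 0)%VS -> (U ^+ k = 0)%VS.
Proof. by move=> /subnK <- Um; rewrite expvD Um prodv0. Qed.

(* An i-fold bracket with elements of U is a sum of terms y x z with
   y in U ^ a, z in U ^ b and a + b = i, so long brackets vanish. *)
Lemma bracket_chain U m (D : A -> Prop) : (U ^+ m = 0)%VS ->
    (forall x, D x -> exists2 u, u \in U & D (u * x - x * u)) ->
  (exists x, D x) -> D 0.
Proof.
move=> Um step [x0 Dx0].
(* At [i = 0] one of a, b is at least [m]; at [i = m.*2] one may take a = b = 0, which gives x =
   0. *)
pose P i x := forall a b y z, (m.*2 <= a + b + i)%N ->
  y \in (U ^+ a)%VS -> z \in (U ^+ b)%VS -> y * x * z = 0.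
have chain i : exists x, D x /\ P i x.
  elim: i => [|i [x [Dx Px]]].
    exists x0; split=> // a b y z; rewrite addn0 => mab Uy Uz.
    have [ma|am] := leqP m a.
      by move: Uy; rewrite (expv_eq0 ma Um) memv0 => /eqP->; rewrite !mul0r.
    have mb : (m <= b)%N by rewrite -(leq_add2l m) addnn (leq_trans mab) // leq_add2r ltnW.
    by move: Uz; rewrite (expv_eq0 mb Um) memv0 => /eqP->; rewrite mulr0.
  have [u Uu Du] := step x Dx; exists (u * x - x * u); split=> // a b y z.
  rewrite addnS -addSn => mab Uy Uz; rewrite mulrBr mulrBl !mulrA.
  rewrite (Px a.+1 b) ?expvSr ?memv_mul // sub0r -[_ * u * z]mulrA.
  by rewrite (Px a b.+1) ?oppr0 ?expvSl ?memv_mul // addnS -addSn.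
have [x [Dx Px]] := chain m.*2.
suff <- : x = 0 by [].
by rewrite -[x]mul1r -[1 * x]mulr1; apply: (Px 0 0); rewrite // expv0 memv_line.
Qed.

(** Since [x] normalises [U], [J] is a two-sided ideal of the unital algebra [B] generated by [U]
    and [x], with J^k inside U^k B. Modulo [J] only powers of [x] survive in powers of [W], so W^N
    lies in [J] and W^(Nm) = 0. *)
Lemma nilpotent_extension U x m N : (U ^+ m = 0)%VS -> x ^+ N = 0 ->
    {in U, forall u, u * x - x * u \in U} ->
  exists M, ((U + <[x]>) ^+ M = 0)%VS.
Proof.
move=> Um xN nUx; set W := (U + <[x]>)%VS; set B := agenv W; set J := (U * B)%VS.
have UW : (U <= W)%VS by apply: addvSl.
have UB : (U <= B)%VS := subv_trans UW (sub_agenv W).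
have UJ : (U <= J)%VS by rewrite -{1}[U]prodv1; apply: prodvSr; apply: sub1_agenv.
have JB : (J * B <= J)%VS by rewrite /J -prodvA agenvM.
have WU : (W * U <= J)%VS.
  apply/prodvP => _ u /memv_addP[v Uv [_ /vlineP[c ->] ->]] Uu.
  rewrite mulrDl; apply: memvD.
    by apply: memv_mul => //; apply: (subvP UB).
  rewrite -scalerAl; apply: memvZ.
  have -> : x * u = u * x - (u * x - x * u) by rewrite opprB addrCA subrr addr0.
  apply: memvB; last exact: (subvP UJ _ (nUx _ Uu)).
  apply: memv_mul => //; apply: (subvP (sub_agenv W)).
  by apply: (subvP (addvSr U _)); apply: memv_line.
have BJ : (B * J <= J)%VS.
  apply: agenv_modl; rewrite /J prodvA; apply: subv_trans JB.
  exact: prodvSl.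
have BU : (B * U <= J)%VS by apply: subv_trans BJ; apply: prodvSr.
have BUk k : (B * U ^+ k <= U ^+ k * B)%VS.
  elim: k => [|k IH]; first by rewrite expv0 prodv1 prod1v.
  rewrite expvSl prodvA; apply: subv_trans (prodvSl _ BU) _.
  by rewrite /J -!prodvA; apply: prodvSr.
have Jk k : (J ^+ k <= U ^+ k * B)%VS.
  elim: k => [|k IH]; first by rewrite !expv0 prod1v; apply: sub1_agenv.
  rewrite expvSl; apply: subv_trans (prodvSr _ IH) _; rewrite /J.
  rewrite -prodvA [(B * _)%VS]prodvA expvSl -[X in (_ <= X)%VS]prodvA; apply: prodvSr.
  apply: subv_trans (prodvSl _ (BUk k)) _.
  by rewrite -prodvA agenvM.
have Wi i : (W ^+ i <= J + <[x ^+ i]>)%VS.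
  elim: i => [|i IH]; first by rewrite expv0 expr0 addvSr.
  rewrite expvSl; apply: subv_trans (prodvSr _ IH) _.
  rewrite prodvDr subv_add; apply/andP; split.
    apply: subv_trans (addvSl _ _); apply: subv_trans BJ.
    by apply: prodvSl; apply: sub_agenv.
  rewrite prodvDl subv_add; apply/andP; split.
    apply: subv_trans (addvSl _ _); apply: prodvSr; rewrite -expv_line.
    apply: subv_trans (expvS i (addvSr U _)) _; exact: subX_agenv.
  by apply: subv_trans (addvSr _ _); rewrite prodv_line exprS.
exists (N * m)%N; apply/eqP; rewrite -subv0 expvM.
apply: (@subv_trans _ _ (J ^+ m)%VS).
  by apply: expvS; apply: subv_trans (Wi N) _; rewrite xN addv0.
by apply: subv_trans (Jk m) _; rewrite Um prod0v.
Qed.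

Variable L : {vspace A}.
Hypothesis bracketL : {in L &, forall x y, x * y - y * x \in L}.
Hypothesis nilL : {in L, forall x, exists N, x ^+ N = 0}.

(** A subspace [U] of [L] with a vanishing power, not necessarily a subalgebra, grows by one vector
    of [L] normalising it until it fills [L]. *)
Theorem Engel : exists m, (L ^+ m = 0)%VS.
Proof.
have : exists U m, (U <= L)%VS /\ (U ^+ m = 0)%VS.
  by exists 0%VS, 1%N; rewrite sub0v expv1.
case=> U [m []]; move: {2}(\dim L - \dim U)%N (leqnn (\dim L - \dim U)) => d.
elim: d U m => [|d IH] U m dU UL Um.
  exists m; suff -> : L = U by [].
  by apply/eqP; rewrite eq_sym eqEdim UL -subn_eq0 -leqn0.
have [LU|/subvPn[x0 Lx0 Ux0]] := boolP (L <= U)%VS.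
  by exists m; have /eqP -> : L == U by rewrite eqEsubv LU UL.
have [x [Lx Ux nx]] : exists x, [/\ x \in L, x \notin U &
    {in U, forall u, u * x - x * u \in U}].
  apply: contrapT => H.
  suff [_] : 0 \in L /\ 0 \notin U by rewrite mem0v.
  (* Were no vector of [L] outside [U] to normalise [U], one could bracket forever outside [U], yet
     long brackets reach 0. *)
  apply: (bracket_chain Um (D := fun x => x \in L /\ x \notin U)); last by exists x0.
  move=> x [Lx Ux]; apply: contrapT => H2; apply: H; exists x; split=> // u Uu.
  apply: contrapT => /negP nU; apply: H2; exists u => //; split=> //.
  by apply: bracketL => //; apply: (subvP UL).
have [N xN] := nilL Lx; have [M WM] := nilpotent_extension Um xN nx.
apply: (IH (U + <[x]>)%VS M) => //; last by rewrite subv_add UL -memvE.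
rewrite -ltnS (leq_trans _ dU) //.
have : (\dim U < \dim (U + <[x]>))%N.
  rewrite ltnNge; apply/negP => dW; have : (U + <[x]> <= U)%VS.
    have -> // : (U + <[x]> = U)%VS by apply/esym/eqP; rewrite eqEdim addvSl.
  by rewrite subv_add -memvE (negbTE Ux) andbF.
have : (\dim (U + <[x]>) <= \dim L)%N by apply: dimvS; rewrite subv_add UL -memvE.
lia.
Qed.

(** Without a nonzero central element, every nonzero element has a nonzero bracket with some element
    of [L]; this contradicts [bracket_chain]. *)
Lemma nilpotent_center_neq0 : L != 0%VS ->
  exists z, [/\ z \in L, z != 0 & {in L, forall x, x * z = z * x}].
Proof.
move=> L0; have [m Lm] := Engel; apply: contrapT => H.
suff [_] : (0 : A) \in L /\ (0 : A) != 0 by rewrite eqxx.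
apply: (bracket_chain Lm (D := fun x => x \in L /\ x != 0)); last first.
  by exists (vpick L); rewrite memv_pick vpick0.
move=> x [Lx x0]; apply: contrapT => H2; apply: H; exists x; split=> // u Lu.
apply: contrapT => ne; apply: H2; exists u => //; split; first exact: bracketL.
by apply/eqP => /eqP; rewrite subr_eq0 => /eqP.
Qed.

End Engel.

(** * Nilpotent matrices *)

Lemma vspace_of_pred (K : fieldType) (V : vectType K) (P : V -> Prop) :
    P 0 -> (forall a x y, P x -> P y -> P (a *: x + y)) ->
  exists U : {vspace V}, forall x, x \in U <-> P x.
Proof.
move=> P0 Plin.
have : exists U : {vspace V}, forall x, x \in U -> P x.
  by exists 0%VS => x; rewrite memv0 => /eqP ->.
case=> U; move: {2}(\dim {: V} - \dim U)%N (leqnn (\dim {: V} - \dim U)) => d.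
elim: d U => [|d IH] U dU UP.
  exists U => x; split=> [/UP //|_]; suff -> : U = fullv by exact: memvf.
  by apply/eqP; rewrite eqEdim subvf -subn_eq0 -leqn0.
have [H|] := pselect (forall x, P x -> x \in U); first by exists U => x; split=> [/UP|/H].
move=> /existsNP[x /not_implyP[Px /negP Ux]].
apply: (IH (U + <[x]>)%VS) => [|y /memv_addP[u /UP Pu [_ /vlineP[c ->] ->]]]; last first.
  by rewrite addrC; apply: Plin.
have ltU : (\dim U < \dim (U + <[x]>))%N.
  rewrite ltnNge; apply/negP => dW; have : (U + <[x]> <= U)%VS.
    have -> // : (U + <[x]> = U)%VS by apply/esym/eqP; rewrite eqEdim addvSl.
  by rewrite subv_add -memvE (negbTE Ux) andbF.
have := dimvS (subvf (U + <[x]>)%VS); lia.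
Qed.

Section NilpotentMatrices.
Variables (K : numClosedFieldType) (n' : nat).
Local Notation n := n'.+1.
Implicit Types (X Y Z e : 'M[K]_n).

(** The characteristic polynomial splits over [K], and every eigenvalue has vanishing N-th power. *)
Lemma nilpotent_char_poly X N : X ^+ N = 0 -> char_poly X = 'X^n.
Proof.
move=> XN; have [r Hr] := closed_field_poly_normal (char_poly X).
rewrite (monicP (char_poly_monic X)) scale1r in Hr.
have r0 z : z \in r -> z = 0.
  move=> zr; have : eigenvalue X z by rewrite eigenvalue_root_char Hr root_prod_XsubC.
  case/eigenvalueP => v vX v0; have vXk k : v *m X ^+ k = z ^+ k *: v.
    elim: k => [|k IH]; first by rewrite expr0 mulmx1 scale1r.
    by rewrite exprS -[X * _]/(X *m _) mulmxA vX -scalemxAl IH scalerA exprS.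
  move: (vXk N); rewrite XN mulmx0 => /esym/eqP.
  by rewrite scaler_eq0 (negbTE v0) orbF expf_eq0 => /andP[_ /eqP].
have szr : size r = n.
  by have := size_char_poly X; rewrite Hr size_prod_XsubC => -[].
rewrite Hr -szr (eq_big_seq (fun=> 'X)) => [|z /r0 ->]; last by rewrite subr0.
by rewrite big_const_seq iter_mulr_1 count_predT.
Qed.

Lemma char_poly_nilpotent X : char_poly X = 'X^n -> X ^+ n = 0.
Proof.
by move=> cX; have := Cayley_Hamilton X; rewrite cX rmorphXn /= horner_mx_X.
Qed.

Lemma nilpotent_index X N : X ^+ N = 0 -> X ^+ n = 0.
Proof. by move/nilpotent_char_poly/char_poly_nilpotent. Qed.

Lemma mxtrace_nilpotent X N : X ^+ N = 0 -> \tr X = 0.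
Proof.
move=> /nilpotent_char_poly cX; have := @char_poly_trace _ n X isT.
by rewrite cX coefXn /= ltn_eqF // => /esym/eqP; rewrite oppr_eq0 => /eqP.
Qed.

Lemma mxtrace_mul_nilpotent X Z N : X ^+ N = 0 -> X * Z = Z * X -> \tr (X *m Z) = 0.
Proof.
by move=> XN XZ; apply: (@mxtrace_nilpotent _ N); rewrite exprMn_comm // XN mul0r.
Qed.

Lemma unitmx_nilpotentD1 X N : X ^+ N = 0 -> 1 + X \in unitmx.
Proof.
move=> XN; have E : (1 + X) * \sum_(i < N) (- X) ^+ i = 1.
  have := subrX1 (- X) N; rewrite exprNn XN mulr0 sub0r => /(congr1 -%R).
  by rewrite opprK -mulNr opprB opprK => <-.
by have [] := mulmx1_unit E.
Qed.

Lemma unitmx_expmx X : X ^+ n = 0 -> expmx X \in unitmx.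
Proof.
move=> Xn; pose Q : 'M[K]_n := \sum_(k < n') (k.+1`!%:R)^-1 *: X ^+ k.
have -> : expmx X = 1 + X * Q.
  rewrite /expmx big_ord_recl expr0 fact0 invr1 scale1r /Q mulr_sumr; congr (_ + _).
  by apply: eq_bigr => k _; rewrite -scalerAr -exprS.
apply: (@unitmx_nilpotentD1 _ n); rewrite exprMn_comm ?Xn ?mul0r //.
rewrite /GRing.comm mulr_sumr mulr_suml; apply: eq_bigr => k _.
by rewrite -scalerAr -scalerAl -exprS -exprSr.
Qed.

Lemma ad_nilpotent X Y : X ^+ n = 0 -> iter n.*2 (ad X) Y = 0.
Proof.
move=> Xn; have XN k : (n <= k)%N -> X ^+ k = 0.
  by move=> /subnK <-; rewrite exprD Xn mulr0.
(* The powers of [X] on both sides make induction on [k] possible: each [ad] moves one more [X] to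
   the left or right. *)
suff H k a b : (n.*2 <= a + b + k)%N -> X ^+ a * iter k (ad X) Y * X ^+ b = 0.
  by have := H n.*2 0 0 (leqnn _); rewrite !expr0 mul1r mulr1.
elim: k a b => [|k IH] a b nab.
  have [na|an] := leqP n a; first by rewrite XN // !mul0r.
  by rewrite [X ^+ b]XN ?mulr0 //; lia.
rewrite iterS {1}/ad -![_ *m _]/(_ * _) mulrBr mulrBl !mulrA -exprSr IH; last by lia.
by rewrite -[_ * X * _]mulrA -exprS IH ?subr0 //; lia.
Qed.

Lemma char_poly_horner X t : (char_poly X).[t] = \det (t%:M - X).
Proof.
rewrite /char_poly -[LHS]/(horner_eval t _) -det_map_mx; congr (\det _).
by apply/matrixP => i j; rewrite !mxE /= /horner_eval !hornerE hornerMn hornerX.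
Qed.

(** The value of the characteristic polynomial at a fixed scalar is a polynomial in the matrix, and
    the values at natural numbers determine it. *)
Lemma char_poly_closure (A : set 'M[K]_n) X p :
  (forall Y, A Y -> char_poly Y = p) -> zariski_closure A X -> char_poly X = p.
Proof.
move=> Ap AX; apply: poly_eq_eval => k; rewrite char_poly_horner.
apply/eqP; rewrite -subr_eq0; apply/eqP.
apply: (@polyfun_closure _ _ (fun Y => \det (k%:R%:M - Y) - p.[k%:R]) A X) => //.
  apply: (@polyfunD _ _ (fun Y => \det (k%:R%:M - Y)) (fun=> - p.[k%:R])); last exact: polyfun_cst.
  apply: polyfun_det => i j; rewrite (_ : (fun Y => _) =
    fun Y : 'M[K]_n => (k%:R%:M : 'M[K]_n) i j + -1 * Y i j); last first.
    by apply/funext => Y; rewrite !mxE mulN1r.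
  apply: polyfunD; first exact: polyfun_cst.
  apply: polyfunM; first exact: polyfun_cst.
  exact: polyfun_entry.
by move=> Y /Ap <-; rewrite char_poly_horner subrr.
Qed.

Lemma char_poly_Ad g X : g \in unitmx -> char_poly (Ad g X) = char_poly X.
Proof.
move=> ug; apply: poly_eq_eval => k; rewrite !char_poly_horner.
have -> : k%:R%:M - Ad g X = g *m (k%:R%:M - X) *m invmx g.
  rewrite mulmxBr mulmxBl -[_%:M]scalemx1 -scalemxAr -scalemxAl mulmx1 mulmxV //.
by rewrite !det_mulmx mulrAC -det_mulmx mulmxV // det1 mul1r.
Qed.

Lemma mxtrace_idem e : e * e = e -> \tr e = (\rank e)%:R.
Proof.
move=> ee; rewrite -{1}(mulmx_base e) mxtrace_mulC.
have := row_base_free e; have := col_base_full e; have := mulmx_base e.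
move: (col_base e) (row_base e) => c r cr /row_fullP[C HC] /row_freeP[B HB].
suff -> : r *m c = 1%:M by rewrite mxtrace1.
have : c *m (r *m c) *m r = c *m r.
  by rewrite !mulmxA cr -mulmxA cr.
move/(congr1 (fun M => C *m (M *m B))).
by rewrite -!mulmxA HB !mulmx1 !mulmxA HC !mul1mx.
Qed.

(** The two annihilating polynomials in [Y] are coprime. Induction on [M] reduces to [A *m Y = 0],
    where [Y + d] acts on [A] as [d]. *)
Lemma coprime_annihilator (A Y : 'M[K]_n) d N M : d != 0 ->
  A *m (Y + d%:M) ^+ N = 0 -> A *m Y ^+ M = 0 -> A = 0.
Proof.
move=> d0; elim: M A => [|M IH] A AN AM; first by rewrite expr0 mulmx1 in AM.
have comY : (Y + d%:M) ^+ N * Y = Y * (Y + d%:M) ^+ N.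
  by apply/esym/commrX; rewrite /GRing.comm mulrDl mulrDr; congr (_ + _); apply: scalar_mxC.
have AY : A *m Y = 0.
  apply: IH; last by rewrite -mulmxA -[Y *m _]/(Y * _) -exprS.
  by rewrite -mulmxA -[Y *m _]/(Y * _) -comY mulmxA AN mul0mx.
have AYd k : A *m (Y + d%:M) ^+ k = d ^+ k *: A.
  elim: k => [|k IHk]; first by rewrite expr0 mulmx1 scale1r.
  rewrite exprS -[(Y + _) * _]/(_ *m _) mulmxA mulmxDr AY add0r scalar_mxC.
  by rewrite mul_scalar_mx -scalemxAl IHk scalerA exprS.
by move: AN => /eqP; rewrite AYd scaler_eq0 expf_eq0 (negbTE d0) andbF => /eqP.
Qed.

Section SpectralElement.
Variables (X : 'M[K]_n) (L : seq K) (e : K -> 'M[K]_n).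
Hypothesis sp : spectral X L e.

Lemma spectral_mulC l : l \in L -> X * e l = e l * X.
Proof. by move=> lL; have [_ _ _ _ com] := sp; rewrite (com l lL X). Qed.

Lemma spectral_idem l : l \in L -> e l * e l = e l.
Proof. by move=> lL; have [_ _ orth _ _] := sp; rewrite orth // eqxx. Qed.

(** On the range of [e l], [X] is [l] plus a nilpotent part of trace 0, and the trace of an
    idempotent is its rank. *)
Lemma spectral_trace l : l \in L -> \tr (X *m e l) = l * (\rank (e l))%:R.
Proof.
move=> lL; rewrite -(mxtrace_idem (spectral_idem lL)).
have [_ _ _ nil _] := sp; have [N HN] := nil l lL.
have eX k : e l ^+ k.+1 = e l.
  by elim: k => [|k IH]; rewrite ?expr1 // exprS IH spectral_idem.
have : \tr ((X - l%:M) *m e l) = 0.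
  apply: (@mxtrace_nilpotent _ N.+1); rewrite exprMn_comm; last first.
    by rewrite /GRing.comm mulrBl mulrBr spectral_mulC //; congr (_ - _); apply/esym/scalar_mxC.
  by rewrite eX exprS -mulrA HN mulr0.
by rewrite mulmxBl mul_scalar_mx linearB linearZ /= => /eqP; rewrite subr_eq0 => /eqP.
Qed.

Lemma spectral_nilpotent : {in L, forall l, l = 0 \/ e l = 0} -> X ^+ n = 0.
Proof.
move=> L0; have [_ s1 _ nil _] := sp.
suff [N HN] : exists N, {in L, forall l, X ^+ N * e l = 0}.
  apply: (@nilpotent_index _ N); rewrite -[X ^+ N]mulr1 -s1 mulr_sumr big_seq.
  by rewrite big1 // => l /HN.
have: {subset L <= L} by []; elim: {1 3}L => [|l s IH] sL; first by exists 0%N.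
have [|N HN] := IH; first by move=> m ms; apply: sL; rewrite inE ms orbT.
have lL : l \in L by apply: sL; rewrite mem_head.
have [M HM] : exists M, X ^+ M * e l = 0.
  have [M HM] := nil l lL; exists M; case: (L0 l lL) => [l0|->]; last by rewrite mulr0.
  by move: HM; rewrite {1}l0 raddf0 subr0.
exists (N + M)%N => m; rewrite inE => /orP[/eqP ->|ms].
  by rewrite exprD -mulrA HM mulr0.
by rewrite addnC exprD -mulrA HN // mulr0.
Qed.

(** By induction [e l] commutes with [X, Y], so [e l, Y] commutes with [X], hence with [e l]; for an
    idempotent this forces [e l, Y] = 0. *)
Lemma spectral_ad_commute l Y k : l \in L -> iter k (ad X) Y = 0 -> e l * Y = Y * e l.
Proof.
move=> lL; have el := spectral_idem lL; have [_ _ _ _ com] := sp.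
elim: k Y => [|k IH] Y; first by move=> /= ->; rewrite mulr0 mul0r.
rewrite iterSr => /IH eY.
have XC : X * (e l * Y - Y * e l) = (e l * Y - Y * e l) * X.
  apply/eqP; rewrite -subr_eq0; apply/eqP.
  have -> : X * (e l * Y - Y * e l) - (e l * Y - Y * e l) * X =
      e l * ad X Y - ad X Y * e l.
    rewrite /ad -![_ *m _]/(_ * _) !mulrBr !mulrBl !mulrA (spectral_mulC lL).
    rewrite -![_ * e l * X]mulrA -(spectral_mulC lL) !mulrA.
    by rewrite !opprB addrACA [RHS]addrACA; congr (_ + _); rewrite addrC.
  by rewrite eY subrr.
have E : e l * Y - e l * Y * e l = e l * Y * e l - Y * e l.
  by have := com l lL _ XC; rewrite mulrBr mulrBl !mulrA el -[Y * e l * e l]mulrA el.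
(* Multiplying [E] by [e l] on either side kills one of its two members. *)
have eYe : e l * Y = e l * Y * e l.
  have := congr1 (fun M => e l * M) E.
  by rewrite /= !mulrBr !mulrA el subrr => /eqP; rewrite subr_eq0 => /eqP.
have eYe' : Y * e l = e l * Y * e l.
  have := congr1 (fun M => M * e l) E.
  rewrite /= !mulrBl -!mulrA el subrr => /esym/eqP; rewrite subr_eq0 => /eqP E3.
  by rewrite -{1}E3 mulrA.
by rewrite eYe -eYe'.
Qed.

End SpectralElement.

End NilpotentMatrices.

(** * The trace form *)

Section TraceForm.
Variables (K : numClosedFieldType) (n' : nat).
Local Notation n := n'.+1.
Variable G : set 'M[K]_n.
Hypothesis gG : subgroup G.
Implicit Types (X Y Z H g : 'M[K]_n).

Definition trace_radical X := Lie G X /\ forall Y, Lie G Y -> \tr (X *m Y) = 0.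

(* The conjugate [C] of the semisimple part of [X] lies in the Lie algebra, and
   tr(X C) is the sum of the |l|^2 over the eigenvalues l of X. *)
Lemma trace_radical_nilpotent X : trace_radical X -> X ^+ n = 0.
Proof.
move=> [LX X0]; have [L [e sp]] := spectral_exists X.
apply: (spectral_nilpotent sp) => l lL; have [uL _ _ _ _] := sp.
have LC : Lie G (fcalc L e Num.conj) by apply: (Lie_fcalc sp gG LX) => x y; rewrite rmorphD.
have : \sum_(m <- L) `|m| ^+ 2 * (\rank (e m))%:R = 0.
  rewrite -[RHS](X0 _ LC) /fcalc mulmx_sumr linear_sum /=; apply: eq_big_seq => m mL.
  by rewrite -scalemxAr linearZ /= (spectral_trace sp mL) normCKC mulrA.
rewrite (bigD1_seq l) //= => /eqP; rewrite paddr_eq0 ?sumr_ge0 //; last 2 first.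
- by rewrite mulr_ge0 ?exprn_ge0.
- by move=> m _; rewrite mulr_ge0 ?exprn_ge0.
rewrite mulf_eq0 expf_eq0 normr_eq0 pnatr_eq0 mxrank_eq0 /= => /andP[/orP[]/eqP -> _].
  by left.
by right.
Qed.

Lemma trace_radical_linear a X Y :
  trace_radical X -> trace_radical Y -> trace_radical (a *: X + Y).
Proof.
move=> [LX X0] [LY Y0]; split=> [|Z LZ]; first exact: Lie_linear.
by rewrite mulmxDl -scalemxAl linearD linearZ /= X0 // Y0 // mulr0 addr0.
Qed.

Lemma trace_radical0 : trace_radical 0.
Proof. by split=> [|Z _]; [apply: Lie0|rewrite mul0mx linear0]. Qed.

Lemma mxtrace_bracket X Y Z : \tr ((X *m Y - Y *m X) *m Z) = \tr (X *m (Y *m Z - Z *m Y)).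
Proof.
rewrite mulmxBl mulmxBr !linearB /= !mulmxA; congr (_ - _).
by rewrite -[Y *m X *m Z]mulmxA mxtrace_mulC.
Qed.

Lemma trace_radical_bracket X Y :
  trace_radical X -> Lie G Y -> trace_radical (X *m Y - Y *m X).
Proof.
move=> [LX X0] LY; split=> [|Z LZ]; first exact: Lie_bracket.
by rewrite mxtrace_bracket X0 //; apply: Lie_bracket.
Qed.

Lemma trace_radical_Ad g X : G g -> trace_radical X -> trace_radical (Ad g X).
Proof.
move=> Gg [LX X0]; have ug := subgroup_unit gG Gg; split=> [|Y LY]; first exact: Lie_Ad.
have LY' := Lie_Ad gG (subgroupV gG Gg) LY.
rewrite -(X0 _ LY') /Ad invmxK -!mulmxA mxtrace_mulC -!mulmxA.
by congr (\tr _); rewrite !mulmxA.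
Qed.

Definition trace_radical_center X :=
  trace_radical X /\ forall Y, trace_radical Y -> Y * X = X * Y.

Lemma trace_radical_centerZ a X : trace_radical_center X -> trace_radical_center (a *: X).
Proof.
move=> [rX cX]; split=> [|Y rY].
  by rewrite -[_ *: _]addr0; apply: trace_radical_linear => //; apply: trace_radical0.
by rewrite -scalerAr -scalerAl cX.
Qed.

Lemma trace_radical_center_Ad g X :
  G g -> trace_radical_center X -> trace_radical_center (Ad g X).
Proof.
move=> Gg [rX cX]; have ug := subgroup_unit gG Gg.
split=> [|Y rY]; first exact: trace_radical_Ad.
have rY' := trace_radical_Ad (subgroupV gG Gg) rY.
by rewrite -[Y](AdVK _ ug) -!AdMr // cX.
Qed.

Lemma nilpotent_element_Ad g X : G g -> nilpotent_element G X -> nilpotent_element G (Ad g X).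
Proof.
move=> Gg [LX [k Hk]]; have ug := subgroup_unit gG Gg.
split; first exact: Lie_Ad.
exists k => Y LY; have LY' := Lie_Ad gG (subgroupV gG Gg) LY.
rewrite -[Y](AdVK _ ug).
suff -> W : iter k (ad (Ad g X)) (Ad g W) = Ad g (iter k (ad X) W).
  by rewrite Hk // /Ad mulmx0 mul0mx.
elim: k {Hk} => //= k ->; rewrite /ad -!AdM //.
by rewrite /Ad -mulmxBl -mulmxBr.
Qed.

Lemma nilpotent_element_commute X L e h Y : nilpotent_element G X -> spectral X L e ->
  Lie G Y -> fcalc L e h * Y = Y * fcalc L e h.
Proof.
move=> [LX [k Hk]] sp LY; rewrite /fcalc mulr_suml mulr_sumr; apply: eq_big_seq => l lL.
by rewrite -scalerAl -scalerAr (spectral_ad_commute sp lL (Hk Y LY)).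
Qed.

(** For the nondegenerate trace form, the image of H -> [H, X] is the orthogonal of the centralizer
    of [X]. It contains [X]: if [Z] commutes with [X] then XZ is nilpotent, so has trace 0. *)
Lemma nilpotent_in_bracket X : (forall Y, trace_radical Y -> Y = 0) ->
  Lie G X -> X ^+ n = 0 -> exists H, Lie G H /\ H *m X - X *m H = X.
Proof.
move=> rad0 LX Xn.
have [U HU] := vspace_of_pred (@Lie0 _ _ G) (@Lie_linear _ _ G).
pose d := \dim U; pose b (i : 'I_d) : 'M[K]_n := (vbasis U)`_i.
have Lb i : Lie G (b i) by apply/HU/vbasis_mem/mem_nth; rewrite size_tuple.
pose x Y : 'rV[K]_d := \row_i coord (vbasis U) i Y.
have xE Y : Lie G Y -> Y = \sum_i x Y 0 i *: b i.
  by move=> /HU UY; rewrite {1}(coord_vbasis UY); apply: eq_bigr => i _; rewrite mxE.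
have Lsum (v : 'rV[K]_d) : Lie G (\sum_i v 0 i *: b i).
  by apply: (big_ind (Lie G)) => [|Y Z|i _]; [apply: Lie0|apply: LieD|apply: LieZ].
pose M : 'M[K]_d := \matrix_(i, j) \tr (b i *m b j).
have Mtr (v : 'rV[K]_d) j : (v *m M) 0 j = \tr ((\sum_i v 0 i *: b i) *m b j).
  rewrite mxE mulmx_suml linear_sum; apply: eq_bigr => i _.
  by rewrite -scalemxAl linearZ mxE.
(* The Gram matrix of the trace form is invertible by nondegeneracy. *)
have uM : M \in unitmx.
  rewrite -row_free_unit -kermx_eq0; apply/rowV0P => v /sub_kermxP vM.
  suff s0 : \sum_i v 0 i *: b i = 0.
    apply/rowP => i; rewrite mxE.
    have /freeP/(_ (fun i => v 0 i) s0 i) // := basis_free (vbasisP U).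
  apply: rad0; split=> // Y LY; rewrite (xE Y LY) mulmx_sumr linear_sum big1 //.
  by move=> j _; rewrite -scalemxAr linearZ /= -Mtr vM [X in _ * X]mxE mulr0.
(* The row space of [A] is the image of H -> [H, X] in coordinates. *)
pose A : 'M[K]_d := \matrix_i x (b i *m X - X *m b i).
suff /submxP[h xXA] : (x X <= A)%MS.
  exists (\sum_i h 0 i *: b i); split=> //.
  rewrite mulmx_suml mulmx_sumr -sumrB [RHS](xE X LX) xXA.
  transitivity (\sum_i h 0 i *: \sum_j A i j *: b j).
    apply: eq_bigr => i _; rewrite -scalemxAl -scalemxAr -scalerBr; congr (_ *: _).
    rewrite [LHS]xE; last exact: Lie_bracket.
    by apply: eq_bigr => j _; rewrite !mxE.
  under eq_bigr => i _ do rewrite scaler_sumr.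
  rewrite exchange_big /=; apply: eq_bigr => j _; rewrite mxE scaler_suml.
  by apply: eq_bigr => i _; rewrite scalerA.
rewrite submxE; apply/eqP/rowP => k; rewrite [RHS]mxE.
pose c := col k (cokermx A); have Ac : A *m c = 0 by rewrite /c colE mulmxA mulmx_coker mul0mx.
have -> : (x X *m cokermx A) 0 k = (x X *m c) 0 0 by rewrite [LHS]mxE [RHS]mxE; apply: eq_bigr => i _; congr (_ * _); rewrite [RHS]mxE.
(* The linear form [c], which kills the image, is represented by [Z] through the trace form ([trZ]);
   invariance of the form makes [Z] commute with [X]. *)
pose z := c^T *m invmx M; pose Z := \sum_i z 0 i *: b i.
have LZ : Lie G Z by apply: Lsum.
have trZ Y : Lie G Y -> \tr (Y *m Z) = (x Y *m c) 0 0.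
  move=> LY; rewrite mxtrace_mulC [X in _ *m X](xE Y LY) mulmx_sumr linear_sum [RHS]mxE.
  apply: eq_bigr => i _; rewrite -scalemxAr linearZ /= -Mtr mulmxKV //.
  by congr (_ * _); rewrite mxE.
have comXZ : X *m Z = Z *m X.
  apply/eqP; rewrite -subr_eq0; apply/eqP; apply: rad0.
  split=> [|Y LY]; first exact: Lie_bracket.
  rewrite mxtrace_mulC [X in X *m _](xE Y LY) mulmx_suml linear_sum big1 // => i _.
  rewrite -scalemxAl linearZ /= -mxtrace_bracket trZ; last exact: Lie_bracket.
  have -> : x (b i *m X - X *m b i) = row i A by rewrite rowK.
  by rewrite -row_mul Ac row0 [X in _ * X]mxE mulr0.
by rewrite -trZ // (mxtrace_mul_nilpotent Xn comXZ).
Qed.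

End TraceForm.

(** * Curves in algebraic groups *)

From mathcomp Require Import topology normedtype sequences complex exp.
Import numFieldNormedType.Exports.

Section Curves.
Local Open Scope classical_set_scope.
Variables (R : realType) (n : nat).
Implicit Types (g h s : 'M[Cplx R]_n) (G H S T Z : set 'M[Cplx R]_n).

(** Continuity is tested on real and imaginary parts, which suffices for preimages of Zariski closed
    sets. *)
Definition ccontinuous (c : R -> Cplx R) :=
  continuous (fun u => complex.Re (c u)) /\ continuous (fun u => complex.Im (c u)).

Lemma ccontinuous_cst a : ccontinuous (fun=> a).
Proof. by split=> u; apply: cst_continuous. Qed.

Lemma ccontinuousD c d :
  ccontinuous c -> ccontinuous d -> ccontinuous (fun u => c u + d u).
Proof.
move=> [Rc Ic] [Rd Id]; split=> u.
  rewrite (_ : (fun u => _) = fun u => complex.Re (c u) + complex.Re (d u)); last first.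
    by apply/funext => v; rewrite raddfD.
  exact: cvgD (Rc u) (Rd u).
rewrite (_ : (fun u => _) = fun u => complex.Im (c u) + complex.Im (d u)); last first.
  by apply/funext => v; rewrite raddfD.
exact: cvgD (Ic u) (Id u).
Qed.

Lemma ccontinuousM c d :
  ccontinuous c -> ccontinuous d -> ccontinuous (fun u => c u * d u).
Proof.
move=> [Rc Ic] [Rd Id]; split=> u.
  rewrite (_ : (fun u => _) = fun u =>
      complex.Re (c u) * complex.Re (d u) - complex.Im (c u) * complex.Im (d u)); last first.
    by apply/funext => v; case: (c v) (d v) => ? ? [].
  exact: cvgB (cvgM (Rc u) (Rd u)) (cvgM (Ic u) (Id u)).
rewrite (_ : (fun u => _) = fun u =>
    complex.Re (c u) * complex.Im (d u) + complex.Im (c u) * complex.Re (d u)); last first.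
  by apply/funext => v; case: (c v) (d v) => ? ? [].
exact: cvgD (cvgM (Rc u) (Id u)) (cvgM (Ic u) (Rd u)).
Qed.

Definition mxcontinuous (c : R -> 'M[Cplx R]_n) :=
  forall i j, ccontinuous (fun u => c u i j).

Lemma ccontinuous_mxeval (f : mxpolynomial (Cplx R) n) c :
  mxcontinuous c -> ccontinuous (fun u => mxeval f (c u)).
Proof.
move=> cc; apply: (mxeval_ind (P := fun e => ccontinuous (fun u => e (c u)))).
- exact: ccontinuous_cst.
- exact: cc.
- by move=> u v; apply: ccontinuousD.
- by move=> u v; apply: ccontinuousM.
Qed.

Lemma closed_preimage Z c :
  zariski_closed Z -> mxcontinuous c -> closed [set u | Z (c u)].
Proof.
move=> [S ->] cc.
have -> : [set u | zero_locus S (c u)] =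
    \bigcap_(f in S) [set u | mxeval f (c u) = 0] by [].
apply: closed_bigI => f _; have [Rf If] := ccontinuous_mxeval f cc.
have -> : [set u | mxeval f (c u) = 0] =
    (fun u => complex.Re (mxeval f (c u))) @^-1` [set 0] `&`
    (fun u => complex.Im (mxeval f (c u))) @^-1` [set 0].
  apply/seteqP; split=> u /= [] => [->//|]; case: (mxeval _ _) => a b /= -> -> //.
apply: closedI; apply: closed_comp => // => [u _|]; exact: closed_eq.
Qed.

(** The preimages of [Z1] and [Z2] are complementary closed subsets of the connected real line. *)
Lemma curve_split Z1 Z2 c : zariski_closed Z1 -> zariski_closed Z2 -> mxcontinuous c ->
    (forall u, Z1 (c u) \/ Z2 (c u)) -> (forall u, Z1 (c u) -> ~ Z2 (c u)) ->
  Z1 (c 0) -> Z1 (c 1).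
Proof.
move=> cZ1 cZ2 cc cov dis Z0.
have cT : connected [set: R] by apply/connected_intervalP.
have : [set u | Z1 (c u)] = [set: R].
  apply: cT; first by exists 0.
    exists [set u | Z1 (c u)]; last by rewrite setTI.
    rewrite -(setCK [set u | Z1 (c u)]) openC.
    have -> : ~` [set u | Z1 (c u)] = [set u | Z2 (c u)].
      by apply/seteqP; split=> u /= H; [case: (cov u)|move=> /dis].
    exact: closed_preimage.
  exists [set u | Z1 (c u)]; last by rewrite setTI.
  exact: closed_preimage.
by move=> E; have : [set: R] 1 by []; rewrite -E.
Qed.

Lemma mxcontinuous_mul x c : mxcontinuous c -> mxcontinuous (fun u => x *m c u).
Proof.
move=> cc i j; rewrite (_ : (fun u => _) = fun u => \sum_k x i k * c u k j); last first.
  by apply/funext => u; rewrite mxE.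
elim: (index_enum _) => [|k r IH].
  rewrite (_ : (fun u => _) = fun=> 0); first exact: ccontinuous_cst.
  by apply/funext => u; rewrite big_nil.
rewrite (_ : (fun u => _) =
  fun u => x i k * c u k j + \sum_(l <- r) x i l * c u l j); last first.
  by apply/funext => u; rewrite big_cons.
by apply: ccontinuousD => //; apply: ccontinuousM => //; apply: ccontinuous_cst.
Qed.

Definition curve_connected S := forall s, S s ->
  exists c, [/\ mxcontinuous c, forall u, S (c u), c 0 = 1%:M & c 1 = s].

(** A curve in [S] from 1 to [s], translated by [x], joins [x] to [x *m s] within the generated
    group, so by [curve_split] both lie in the same piece. *)
Lemma generated_curves S Z1 Z2 : S `<=` @GL _ n -> curve_connected S ->
    zariski_closed Z1 -> zariski_closed Z2 ->
    (forall x, generated S x -> Z1 x \/ Z2 x) ->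
    (forall x, generated S x -> Z1 x -> ~ Z2 x) ->
  Z1 1%:M -> generated S `<=` Z1.
Proof.
move=> SGL Sc cZ1 cZ2 cov dis Z11; have gS := subgroup_generated SGL.
have move12 x s : generated S x -> S s -> Z1 x <-> Z1 (x *m s).
  move=> Sx Ss; have [c [cc Gc c0 c1]] := Sc s Ss.
  have Sxc u : generated S (x *m c u).
    by apply: (subgroupM gS) => //; apply: generated_sub.
  have xcc := mxcontinuous_mul x cc.
  split=> [Zx|Zxs].
    rewrite -c1; apply: (curve_split cZ1 cZ2 xcc) => [u|u|]; last by rewrite c0 mulmx1.
      exact: cov.
    exact: dis.
  case: (cov x Sx) => // Zx; exfalso; apply: (dis (x *m s)) => //.
    by rewrite -c1.
  rewrite -c1; apply: (curve_split cZ2 cZ1 xcc) => [u|u Zu /dis|]; last by rewrite c0 mulmx1.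
    by apply/or_comm; apply: cov.
  by apply.
(* The elements whose right multiplication preserves membership in [Z1] form a subgroup containing
   [S]. *)
suff sub : generated S `<=`
    [set y | generated S y /\ forall x, generated S x -> Z1 x <-> Z1 (x *m y)].
  by move=> x /sub[Sx /(_ _ (subgroup1 gS))]; rewrite mul1mx => -[+ _]; apply.
apply: generated_min => [|s Ss]; last first.
  by split=> [|x Sx]; [apply: generated_sub|apply: move12].
split=> /= [y [Sy _]||y z [Sy Zy] [Sz Zz]|y [Sy Zy]].
- exact: (subgroup_unit gS).
- by split=> [|x _]; rewrite ?mulmx1 //; apply: (subgroup1 gS).
- split=> [|x Sx]; first exact: (subgroupM gS).
  by rewrite mulmxA; apply: (iff_trans (Zy x Sx)); apply: Zz; apply: (subgroupM gS).
- split=> [|x Sx]; first exact: (subgroupV gS).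
  have uy := subgroup_unit gS Sy.
  by rewrite (Zy (x *m invmx y)) ?mulmxKV //; apply: (subgroupM gS) => //; apply: (subgroupV gS).
Qed.

Lemma closure_curve_connected S : S `<=` @GL _ n -> curve_connected S ->
  zariski_connected (zariski_closure (generated S) `&` @GL _ n).
Proof.
move=> SGL Sc; have gS := subgroup_generated SGL.
have subH x : generated S x -> (zariski_closure (generated S) `&` @GL _ n) x.
  by move=> Sx; split; [apply: zariski_closure_sub|apply: (subgroup_unit gS)].
have half Z1 Z2 : zariski_closed Z1 -> zariski_closed Z2 ->
    zariski_closure (generated S) `&` @GL _ n `<=` Z1 `|` Z2 ->
    zariski_closure (generated S) `&` @GL _ n `&` Z1 `&` Z2 = set0 ->
    Z1 1%:M -> zariski_closure (generated S) `&` @GL _ n `&` Z2 = set0.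
  move=> cZ1 cZ2 cov dis Z11; rewrite -subset0 => x [Hx Z2x]; rewrite -dis.
  split=> //; split=> //; apply: (zariski_closure_min cZ1 _ Hx.1).
  apply: (generated_curves SGL Sc cZ1 cZ2) => // y /subH Hy.
    exact: cov.
  move=> Z1y Z2y; suff : set0 y by [].
  by rewrite -dis.
move=> Z1 Z2 cZ1 cZ2 cov dis.
case: (cov 1%:M) => [|Z11|Z21]; first exact: subH (subgroup1 gS).
  by right; apply: half dis Z11.
left; apply: (half Z2 Z1) => //; first by rewrite setUC.
by rewrite -dis -!setIA (setIC Z1).
Qed.

(** The closure in GL of the group generated by [S] is algebraic, connected, abelian hence solvable,
    and normal in [G]; semisimplicity makes it trivial. *)
Lemma semisimple_curve_trivial G S : linear_algebraic_group G -> semisimple G ->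
    S `<=` G -> (forall g s, G g -> S s -> S (Ad g s)) ->
    (forall s t, S s -> S t -> s *m t = t *m s) -> curve_connected S ->
  forall s, S s -> s = 1%:M.
Proof.
move=> [gG [Z [cZ GE]]] ssG SG SAd comS Sc.
have SGL : S `<=` @GL _ n by move=> s /SG; apply: subgroup_unit.
have gS := subgroup_generated SGL.
have genG : generated S `<=` G by apply: generated_min.
set H := zariski_closure (generated S) `&` @GL _ n.
suff HE : H = [set 1%:M].
  move=> s Ss; have : H s; last by rewrite HE.
  by split; [apply: zariski_closure_sub; apply: generated_sub|apply: SGL].
have gH : subgroup H by apply: subgroup_closure.
apply: ssG.
- by split=> //; exists (zariski_closure (generated S)); split=> //; apply: zariski_closure_closed.
- exact: closure_curve_connected.
- apply: abelian_solvable => // g h [Hg _] [Hh _]; apply: (closure_commute _ Hg Hh).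
  exact: generated_commute.
- split=> [x [Hx ux]|g x Gg [Hx ux]].
    rewrite GE; split=> //; apply: (zariski_closure_min cZ _ Hx) => y /genG.
    by rewrite GE => -[].
  have ug := subgroup_unit gG Gg.
  split; last exact: Ad_unit.
  apply: (polymap_closure (polymapM (polymapM (polymap_cst g) (@polymap_id _ _))
    (polymap_cst (invmx g))) _ Hx) => y Sy; apply: zariski_closure_sub.
  by apply: (generated_Ad ug SGL _ Sy) => s; apply: SAd.
Qed.

End Curves.

(** * Semisimple groups *)

Section Semisimple.
Variables (R : realType) (n' : nat).
Local Notation K := (Cplx R).
Local Notation n := n'.+1.
Variable G : set 'M[K]_n.
Hypotheses (algG : linear_algebraic_group G) (ssG : semisimple G).
Implicit Types (X Y Z H g : 'M[K]_n).

Local Notation rc u := (real_complex R u : K).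

Let gG : subgroup G. Proof. by case: algG. Qed.

Lemma algebraic_group_closure X : zariski_closure G X -> X \in unitmx -> G X.
Proof.
move=> GX uX; have [_ [Z [cZ GE]]] := algG; rewrite GE; split=> //.
by apply: (zariski_closure_min cZ _ GX) => Y; rewrite GE => -[].
Qed.

Lemma ccontinuous_rc (u : R -> R) : continuous u -> ccontinuous (fun v => rc (u v)).
Proof. by move=> cu; split=> //= v; apply: cst_continuous. Qed.

Lemma ccontinuous_poly (p : {poly K}) : ccontinuous (fun u => p.[rc u]).
Proof.
elim/poly_ind: p => [|p c IH].
  rewrite (_ : (fun u => _) = fun=> 0); first exact: ccontinuous_cst.
  by apply/funext => u; rewrite horner0.
rewrite (_ : (fun u => _) = fun u => p.[rc u] * rc u + c); last first.
  by apply/funext => u; rewrite hornerMXaddC.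
apply: ccontinuousD; last exact: ccontinuous_cst.
by apply: ccontinuousM => //; apply: ccontinuous_rc => u.
Qed.

Lemma semisimple_trace_radical X : trace_radical G X -> X = 0.
Proof.
move=> rX.
have [U HU] := vspace_of_pred (trace_radical0 G) (@trace_radical_linear _ _ G).
have nilU : {in U, forall Y, Y ^+ n = 0}.
  by move=> Y /HU; apply: trace_radical_nilpotent.
have [U0|Un0] := eqVneq U 0%VS.
  by have /HU := rX; rewrite U0 memv0 => /eqP.
have bU : {in U &, forall Y Z, Y * Z - Z * Y \in U}.
  by move=> Y Z /HU rY /HU[LZ _]; apply/HU/trace_radical_bracket.
have [Z [UZ Z0 cZ]] := nilpotent_center_neq0 bU (fun Y UY => ex_intro _ n (nilU Y UY)) Un0.
case/eqP: Z0.
pose S := [set s | exists2 Y, trace_radical_center G Y & s = expmx Y]%classic.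
(* All multiples of the central element [Z] have trivial exponential, so Z = 0. The connecting
   curves are exp(uY) for real u. *)
suff H s : S s -> s = 1%:M.
  apply: expmx_eq1; first exact: nilU.
  move=> k; apply: H; exists (k%:R *: Z) => //; apply: trace_radical_centerZ.
  by split=> [|W /HU UW]; [apply/HU|apply: cZ].
have nilc Y : trace_radical_center G Y -> Y ^+ n = 0 by case=> rY _; apply: trace_radical_nilpotent gG _ rY.
apply: (semisimple_curve_trivial algG ssG) => {s} [s [Y cY ->]|g s Gg [Y cY ->]||s [Y cY ->]].
- apply: algebraic_group_closure; last exact: unitmx_expmx (nilc _ cY).
  by apply: expmx_closure (nilc _ cY) => //; case: cY => -[].
- have ug := subgroup_unit gG Gg.
  exists (Ad g Y); last by rewrite expmx_conj.
  exact: trace_radical_center_Ad.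
- move=> s t [Y [_ cY] ->] [W [rW _] ->]; apply: expmx_commute.
  by rewrite cY.
- exists (fun u => expmx (rc u *: Y)); split.
  + move=> i j; rewrite (_ : (fun u => _) = fun u => (expcurve Y i j).[rc u]).
      exact: ccontinuous_poly.
    by apply/funext => u; rewrite -expcurve_eval mxE.
  + by move=> u; exists (rc u *: Y) => //; apply: trace_radical_centerZ.
  + by rewrite scale0r expmx0.
  + by rewrite scale1r.
Qed.

(** For each [c] a homomorphism from (K, +) to K^*; scaling [c] by a real parameter gives a
    continuous family starting at the trivial one. *)
Definition expRe (c z : K) : K := rc (expR (complex.Re (c * z))).

Lemma expRe_exponential c : exponential_fun (expRe c).
Proof.
rewrite /expRe; split=> [|x y]; first by rewrite mulr0 raddf0 expR0.
by rewrite mulrDr raddfD expRD rmorphM.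
Qed.

Lemma expRe_neq0 c z : expRe c z != 0.
Proof. by rewrite /expRe fmorph_eq0 gt_eqF // expR_gt0. Qed.

Lemma fcalc_expRe_group X L e c : spectral X L e -> Lie G X -> G (fcalc L e (expRe c)).
Proof.
move=> sp LX; apply: algebraic_group_closure; last first.
  by apply: (fcalc_unit sp) => l _; apply: expRe_neq0.
exact: (closure_fcalc sp gG LX (expRe_exponential c)).
Qed.

Lemma nilpotent_element_nilpotent X : nilpotent_element G X -> X ^+ n = 0.
Proof.
pose S := [set s | exists X L e c,
  [/\ nilpotent_element G X, spectral X L e & s = fcalc L e (expRe c)]]%classic.
have S1 s : S s -> s = 1%:M.
  apply: (semisimple_curve_trivial algG ssG) => {s}
    [s [Y [L [e [c [[LY _] sp ->]]]]]|g s Gg [Y [L [e [c [nY sp ->]]]]]|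
     s t [Y [L [e [c [nY sp ->]]]]] [Z [L' [e' [c' [nZ sp' ->]]]]]|
     s [Y [L [e [c [nY sp ->]]]]]].
  - exact: fcalc_expRe_group sp LY.
  - exists (Ad g Y), L, (fun l => Ad g (e l)), c; split.
    + exact: nilpotent_element_Ad.
    + exact: spectral_conj (subgroup_unit gG Gg) sp.
    + exact: fcalc_Ad.
  (* The calculus of the ad-nilpotent [Y] commutes with all of [Lie G], in particular with [Z],
     hence with the calculus of [Z]. *)
  - apply/esym/(spectral_commute _ sp')/esym.
    by apply: (nilpotent_element_commute _ nY sp); case: nZ.
  - exists (fun u => fcalc L e (expRe (rc u * c))); split.
    + move=> i j; rewrite /fcalc.
      rewrite (_ : (fun u => _) = fun u => \sum_(l <- L) expRe (rc u * c) l * e l i j); last first.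
        by apply/funext => u; rewrite summxE; apply: eq_bigr => l _; rewrite mxE.
      elim: (L) => [|l r IH].
        rewrite (_ : (fun u => _) = fun=> 0); first exact: ccontinuous_cst.
        by apply/funext => u; rewrite big_nil.
      rewrite (_ : (fun u => _) = fun u => expRe (rc u * c) l * e l i j +
        \sum_(l <- r) expRe (rc u * c) l * e l i j); last first.
        by apply/funext => u; rewrite big_cons.
      apply: ccontinuousD => //; apply: ccontinuousM; last exact: ccontinuous_cst.
      rewrite /expRe; apply: ccontinuous_rc => u.
      have ccid : ccontinuous (fun u : R => rc u) by apply: ccontinuous_rc => v.
      have cRe := (ccontinuousM (ccontinuousM ccid (ccontinuous_cst c)) (ccontinuous_cst l)).1 u.
      apply: (@continuous_comp _ _ _ (fun u => complex.Re (rc u * c * l)) (@expR R)).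
        exact: cRe.
      exact: continuous_expR.
    + by move=> u; exists Y, L, e, (rc u * c).
    + by apply: (fcalc_eq1 sp) => l _; rewrite /expRe !mul0r expR0.
    + by rewrite mul1r.
move=> nX; have [L [e sp]] := spectral_exists X.
apply: (spectral_nilpotent sp) => l lL.
(* With the conjugate of [l], Re(cl) is the squared modulus of [l], so exp(Re(cl)) = 1 forces l =
   0. *)
pose c : K := Complex (complex.Re l) (- complex.Im l).
have E : fcalc L e (expRe c) = 1%:M by apply: S1; exists X, L, e, c.
have := spectral_fcalc (expRe c) sp lL; rewrite E mul1r => /esym/eqP.
rewrite -subr_eq0 -{2}[e l]scale1r -scalerBl scaler_eq0 => /orP[|/eqP]; last by right.
rewrite subr_eq0 /expRe => /eqP/(congr1 (@complex.Re R)) /= E1; left.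
have : complex.Re (c * l) = 0 by apply: expR_inj; rewrite E1 expR0.
have -> : complex.Re (c * l) = complex.Re l ^+ 2 + complex.Im l ^+ 2.
  by rewrite /c; case: (l) => a b /=; rewrite mulNr opprK !expr2.
move=> /eqP; rewrite paddr_eq0 ?sqr_ge0 // !sqrf_eq0.
by case: (l) => a b /= /andP[/eqP -> /eqP ->].
Qed.

(** With [H, X] = X, the matrix [X] raises generalised eigenvalues of [H] by 1, so conjugating by
    the calculus of [H] rescales [X]. *)
Lemma closure_orbit0 X : Lie G X -> X ^+ n = 0 -> zariski_closure (adjoint_orbit G X) 0.
Proof.
move=> LX Xn; have [H [LH HX]] := nilpotent_in_bracket gG semisimple_trace_radical LX Xn.
have [L [e sp]] := spectral_exists H.
have [_ s1 _ nil _] := sp.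
have eXe l m : l \in L -> m \in L -> l != m + 1 -> e l *m X *m e m = 0.
  move=> lL mL lm; set A := e l *m X *m e m.
  have HA : H *m A = A *m (H + 1).
    have eH := spectral_mulC sp; rewrite /A -![_ *m _]/(_ * _) !mulrA eH //.
    rewrite -[e l * H * X]mulrA -[_ * _ * e m * (H + 1)]mulrA mulrDr mulr1 -eH //.
    have -> : H * X = X + X * H by rewrite -{2}HX subrK.
    by rewrite !mulrDr !mulrDl !mulrA addrC.
  have [N HN] := nil l lL; have [M HM] := nil m mL.
  (* From HA = A(H + 1), right multiplication by a power of H + 1 - l kills [A], and so does one by
     a power of H - m. *)
  apply: (@coprime_annihilator _ _ A (H - m%:M) (m + 1 - l) N M).
  - by rewrite subr_eq0 eq_sym.
  - have -> : H - m%:M + (m + 1 - l)%:M = H + 1 - l%:M.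
      rewrite raddfB raddfD /= -[1%:M]/(1 : 'M[K]_n) !addrA; congr (_ - _).
      by rewrite subrK.
    have HAk k : (H - l%:M) ^+ k *m A = A *m (H + 1 - l%:M) ^+ k.
      elim: k => [|k IH]; first by rewrite mul1mx mulmx1.
      rewrite !exprSr -![_ * _]/(_ *m _) -mulmxA mulmxBl HA.
      by rewrite -scalar_mxC -mulmxBr [LHS]mulmxA IH -mulmxA.
    by rewrite -HAk /A !mulmxA -[_ *m e l]/(_ * e l) HN !mul0mx.
  - rewrite /A -mulmxA -[e m *m _]/(e m * _).
    have -> : e m * (H - m%:M) ^+ M = (H - m%:M) ^+ M * e m.
      apply: commrX; rewrite /GRing.comm mulrBl mulrBr (spectral_mulC sp) //.
      by congr (_ - _); apply: scalar_mxC.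
    by rewrite HM mulmx0.
have XE : X = \sum_(l <- L) \sum_(m <- L) e l *m X *m e m.
  rewrite -[LHS]mul1mx -[LHS]mulmx1 -[1%:M]/(1 : 'M[K]_n) -s1 !mulmx_suml.
  by apply: eq_bigr => l _; rewrite mulmx_sumr.
have scaleX c : fcalc L e (expRe c) *m X = expRe c 1 *: X *m fcalc L e (expRe c).
  set F := fcalc L e (expRe c).
  have Fe l : l \in L -> F *m e l = expRe c l *: e l by exact: spectral_fcalc sp.
  have eF l : l \in L -> e l *m F = expRe c l *: e l.
    move=> lL; rewrite -Fe //; have [_ _ _ _ com] := sp; apply: (com l lL).
    by apply/esym/(spectral_commute _ sp).
  rewrite -scalemxAl {1 2}XE mulmx_sumr mulmx_suml scaler_sumr.
  apply: eq_big_seq => l lL; rewrite mulmx_sumr mulmx_suml scaler_sumr.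
  apply: eq_big_seq => m mL; rewrite -[_ *m F]mulmxA eF // !mulmxA Fe //.
  have [->|lm] := eqVneq l (m + 1); last first.
    by rewrite -scalemxAr -!scalemxAl eXe // !scaler0.
  rewrite (expRe_exponential c).2 -scalemxAr -!scalemxAl scalerA.
  by congr (_ *: _); rewrite mulrC.
have orbitX (c : K) : adjoint_orbit G X (expRe c 1 *: X).
  exists (fcalc L e (expRe c)); first exact: fcalc_expRe_group sp LH.
  by rewrite /Ad scaleX mulmxK // (fcalc_unit sp) // => l _; apply: expRe_neq0.
move=> f If; have [p Hp] := mxeval_curve f (mxline 0 X).
have p0 : p = 0.
  (* The scalars exp(k) are infinitely many, so a polynomial vanishing on the orbit vanishes on the
     whole line through 0 and [X]. *)
  apply: (@poly_eq_inj _ (fun k : nat => expRe (k%:R) 1)) => [i j|k].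
    rewrite /expRe !mulr1 => /(congr1 (@complex.Re R)) /= /expR_inj.
    by rewrite !raddfMn /= => /eqP; rewrite eqr_nat => /eqP.
  rewrite horner0 (Hp _).1 mxline_eval add0r; apply: If; exact: orbitX.
by have := (Hp 0).1; rewrite mxline_eval scale0r addr0 p0 horner0 => <-.
Qed.

End Semisimple.

(** * Nilpotent orbits *)

Section Orbits.
Local Open Scope classical_set_scope.
Variables (R : realType) (n : nat) (G : set 'M[Cplx R]_n).
Hypotheses (algG : linear_algebraic_group G) (ssG : semisimple G).
Implicit Types X Y : 'M[Cplx R]_n.

Let gG : subgroup G. Proof. by case: algG. Qed.

Lemma mem_orbit X : adjoint_orbit G X X.
Proof. by exists 1%:M; [apply: subgroup1|rewrite /Ad mul1mx invmx1 mulmx1]. Qed.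

(** The criterion by the characteristic polynomial passes to orbits and their closures, and it also
    covers matrices of size 0, treated apart here. *)
Lemma nilpotent_elementE X : nilpotent_element G X <-> Lie G X /\ char_poly X = 'X^n.
Proof.
case: n G algG ssG X => [|m] G' algG' ssG' X.
  split=> [[LX _]|[LX _]]; split=> //; first by rewrite /char_poly det_mx00 expr0.
  by exists 0%N => Y _; apply: flatmx0.
split=> [nX|[LX cX]]; split.
- by case: nX.
- exact: nilpotent_char_poly (nilpotent_element_nilpotent algG' ssG' nX).
- exact: LX.
- by exists m.+1.*2 => Y _; apply: ad_nilpotent; apply: char_poly_nilpotent.
Qed.

Lemma nilpotent_closure0 X : nilpotent_element G X -> zariski_closure (adjoint_orbit G X) 0.
Proof.
case: n G algG ssG X => [|m] G' algG' ssG' X nX.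
  rewrite (_ : 0 = X); last by rewrite [X]flatmx0.
  apply: zariski_closure_sub; exists 1%:M; first by case: algG' => -[].
  by rewrite [LHS]flatmx0 [RHS]flatmx0.
by apply: closure_orbit0 => //; [case: nX|apply: nilpotent_element_nilpotent nX].
Qed.

Lemma char_poly_orbit X Y : adjoint_orbit G X Y -> char_poly Y = char_poly X.
Proof.
case: n G algG ssG X Y => [|m] G' algG' ssG' X Y.
  by move=> _; rewrite [Y]flatmx0 [X]flatmx0.
move=> [g Gg <-]; apply: char_poly_Ad.
by case: algG' => gG' _; apply: (subgroup_unit gG').
Qed.

Lemma char_poly_closure_order X Y :
  closure_order G (adjoint_orbit G X) (adjoint_orbit G Y) -> char_poly X = char_poly Y.
Proof.
move=> /(_ X (mem_orbit X))[_]; move: (@char_poly_orbit Y).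
case: n G algG ssG X Y => [|m] G' algG' ssG' X Y cY XY.
  by rewrite [Y]flatmx0 [X]flatmx0.
exact: char_poly_closure XY.
Qed.

Lemma nilpotent_orbitsE X : Lie G X ->
  nilpotent_orbits G (adjoint_orbit G X) <-> char_poly X = 'X^n.
Proof.
move=> LX; split=> [[_ [Y [XY /nilpotent_elementE[_ <-]]]]|cX].
  by rewrite (char_poly_orbit XY).
split; first by exists X.
by exists X; split; [apply: mem_orbit|apply/nilpotent_elementE].
Qed.

Lemma closure_order_nilpotent O1 O2 : adjoint_orbits G O1 -> adjoint_orbits G O2 ->
  closure_order G O1 O2 -> nilpotent_orbits G O1 <-> nilpotent_orbits G O2.
Proof.
move=> [X [LX ->]] [Y [LY ->]] /char_poly_closure_order XY.
have HX := nilpotent_orbitsE LX; have HY := nilpotent_orbitsE LY.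
by split=> [/HX|/HY]; rewrite ?XY => H; [apply/HY|apply/HX]; rewrite ?XY.
Qed.

Lemma nilpotent_orbit0 : nilpotent_orbits G (adjoint_orbit G 0).
Proof.
split; first by exists 0; split; [apply: Lie0|].
exists 0; split; first exact: mem_orbit.
split; first exact: Lie0.
by exists 1%N => Y _; rewrite /= /ad mul0mx mulmx0 subrr.
Qed.

Lemma closure_order0 O : nilpotent_orbits G O -> closure_order G (adjoint_orbit G 0) O.
Proof.
move=> nO; have [[X [LX OX]] _] := nO; move: nO; rewrite OX => /(nilpotent_orbitsE LX) cX.
move=> _ [g Gg <-]; have -> : Ad g 0 = 0 by rewrite /Ad mulmx0 mul0mx.
by split; [apply: Lie0|apply: nilpotent_closure0; apply/nilpotent_elementE].
Qed.

Lemma nilpotent_orbits_component :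
  poset_component (closure_order G) (adjoint_orbits G) (nilpotent_orbits G).
Proof.
have nP O : nilpotent_orbits G O -> adjoint_orbits G O by case.
pose O0 := adjoint_orbit G 0; split=> [//|p q np nq|Q QP nQ zQ O QO].
  (* The path goes from [p] down to the zero orbit and up to [q]; indices start at 1. *)
  exists 3%N, (fun j => if j == 1%N then p else if j == 2%N then O0 else q).
  split=> // [[|[|[|[|j]]]] //= _|[|[|[|j]]] //= _].
  - exact: nilpotent_orbit0.
  - by right; apply: closure_order0.
  - by left; apply: closure_order0.
have [k [r [k1 rQ r1 rk rle]]] := zQ O0 O (nQ _ nilpotent_orbit0) QO.
(* Maximality: nilpotency spreads from the zero orbit along the path, since comparable orbits are
   nilpotent together. *)
suff H j : (1 <= j <= k)%N -> nilpotent_orbits G (r j).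
  by rewrite -rk; apply: H; rewrite k1 leqnn.
elim: j => // -[_ _|j IH jk]; first by rewrite r1; apply: nilpotent_orbit0.
have jk' : (1 <= j.+1 <= k)%N by lia.
have nj := IH jk'; have Pj := QP _ (rQ _ jk'); have Pj1 := QP _ (rQ _ jk).
have [|le|le] := rle j.+1; first by lia.
  exact/(closure_order_nilpotent Pj Pj1 le).
exact/(closure_order_nilpotent Pj1 Pj le).
Qed.

End Orbits.

Theorem proposition6p5 (R : realType) (n : nat) (G : set 'M[Cplx R]_n)
    (algG : linear_algebraic_group G) (connG : zariski_connected G)
    (scG : simply_connected G) (ssG : semisimple G) :
  poset_component (closure_order G) (adjoint_orbits G) (nilpotent_orbits G).
Proof. exact: nilpotent_orbits_component. Qed.
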